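(* Let $\alpha_1,\alpha_2\in(0,1)$, $\lambda_1,\lambda_2>0$, $c_1,c_2\ge0$ with $c_1+c_2=1$. Let $B(t)$ be a standard Brownian motion on $\mathbb{R}$, independent of the mixture tempered stable subordinator $S_{\alpha_1,\lambda_1,\alpha_2,\lambda_2}(t)$. Then the probability density function $r(x,t)$ (i.e. $\mathbb{P}(Z(t)\in dx)=r(x,t)\,dx$) of the time-changed Brownian motion $Z(t)=B(S_{\alpha_1,\lambda_1,\alpha_2,\lambda_2}(t))$, $t>0$, satisfies the space-fractional differential equation $$\frac{\partial}{\partial t}r(x,t)=-c_1\Big(\lambda_1-\frac{\partial^2}{\partial x^2}\Big)^{\alpha_1}r(x,t)-c_2\Big(\lambda_2-\frac{\partial^2}{\partial x^2}\Big)^{\alpha_2}r(x,t)+c_1\lambda_1^{\alpha_1}r(x,t)+c_2\lambda_2^{\alpha_2}r(x,t),$$ with initial and boundary conditions $$r(x,0)=\delta(x),\qquad\lim_{|x|\to\infty}r(x,t)=0,\qquad\lim_{|x|\to\infty}\frac{\partial}{\partial x}r(x,t)=0 .$$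
   Context: The mixture tempered stable subordinator (MTSS) $S_{\alpha_1,\lambda_1,\alpha_2,\lambda_2}(t)$, $t\ge0$, is the Lévy process with Laplace transform $$\mathbb{E}\big(e^{-sS_{\alpha_1,\lambda_1,\alpha_2,\lambda_2}(t)}\big)=\exp\Big(-t\big(c_1((s+\lambda_1)^{\alpha_1}-\lambda_1^{\alpha_1})+c_2((s+\lambda_2)^{\alpha_2}-\lambda_2^{\alpha_2})\big)\Big),\quad s>0 .$$ The operator $\big(\lambda-\frac{\partial^2}{\partial x^2}\big)^{\alpha}$ is understood through the binomial expansion $\sum_{i=0}^\infty\binom{\alpha}{i}\lambda^{\alpha-i}\big(-\frac{\partial^2}{\partial x^2}\big)^i$. $\delta$ is the Dirac delta at $0$.
   Formalization: Brownian motion is normalized to variance 2t, since the printed equation fails for variance t; the operator (λ−∂²/∂x²)^α is the Fourier multiplier (λ+ξ²)^α, since the binomial expansion diverges when applied to r. *)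

(* Defs.v *)
From mathcomp Require Import all_boot all_order all_algebra.
From mathcomp Require Import all_classical all_reals all_analysis.
From mathcomp Require Import ring lra.

Set Implicit Arguments.
Unset Strict Implicit.
Unset Printing Implicit Defensive.

Import Order.TTheory GRing.Theory Num.Theory.
Import numFieldNormedType.Exports.

Local Open Scope classical_set_scope.
Local Open Scope ring_scope.

Section stochastic_processes.
Context (d : measure_display) (T : measurableType d) (R : realType)
  (P : probability T R).

(* Mutual independence of the finite family [X i] (every [A i] may be [setT],
   so the product rule for subfamilies is included). *)
Definition mutually_independent (n : nat) (X : 'I_n -> T -> R) : Prop :=
  forall A : 'I_n -> set R, (forall i, measurable (A i)) ->
    P (\bigcap_(i in [set: 'I_n]) (X i @^-1` A i)) =
    (\prod_(i < n) P (X i @^-1` A i))%E.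

(* Processes are indexed by all of [R]; only times [0 <= t] are constrained. *)
Definition independent_increments (X : R -> {RV P >-> R}) : Prop :=
  forall (n : nat) (t : nat -> R),
    0 <= t 0%N -> (forall i, t i <= t i.+1) ->
    mutually_independent (fun (i : 'I_n) w => X (t i.+1) w - X (t i) w).

Definition stationary_increments (X : R -> {RV P >-> R}) : Prop :=
  forall s t : R, 0 <= s -> 0 <= t -> forall A : set R, measurable A ->
    P [set w | A (X (s + t) w - X s w)] = P [set w | A (X t w - X 0 w)].

Definition stochastically_continuous (X : R -> {RV P >-> R}) : Prop :=
  forall (t e : R), 0 <= t -> 0 < e ->
    P [set w | e <= `|X s w - X t w|] @[s --> within [set s | 0 <= s] (nbhs t)]
      --> 0%E.

Definition cadlag (f : R -> R) : Prop :=
  (forall t : R, 0 <= t -> f s @[s --> t^'+] --> f t) /\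
  (forall t : R, 0 < t -> cvg (f s @[s --> t^'-])).

Definition levy_process (X : R -> {RV P >-> R}) : Prop :=
  [/\ {ae P, forall w, X 0 w = 0},
      independent_increments X,
      stationary_increments X,
      stochastically_continuous X &
      {ae P, forall w, cadlag (fun t => X t w)}].

Definition subordinator (S : R -> {RV P >-> R}) : Prop :=
  levy_process S /\
  {ae P, forall w, forall s t : R, 0 <= s -> s <= t -> S s w <= S t w}.

Definition mixture_tempered_stable_subordinator
    (c1 alpha1 lambda1 c2 alpha2 lambda2 : R) (S : R -> {RV P >-> R}) : Prop :=
  subordinator S /\
  forall s t : R, 0 < s -> 0 <= t ->
    ('E_P[fun w => expR (- s * S t w)])%E =
    (expR (- t * (c1 * ((s + lambda1) `^ alpha1 - lambda1 `^ alpha1)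
                + c2 * ((s + lambda2) `^ alpha2 - lambda2 `^ alpha2))))%:E.

(* Driftless Brownian motion started at [0] with [Var (B t) = v * t]; its
   generator is [(v / 2) d^2/dx^2].  The second parameter of [normal_prob] is
   the standard deviation. *)
Definition brownian_motion (v : R) (B : R -> {RV P >-> R}) : Prop :=
  [/\ {ae P, forall w, B 0 w = 0},
      independent_increments B,
      (forall s t : R, 0 <= s -> s < t -> forall A : set R, measurable A ->
         P [set w | A (B t w - B s w)] =
         normal_prob 0 (Num.sqrt (v * (t - s))) A) &
      {ae P, forall w, {within [set t : R | 0 <= t],
                         continuous (fun t => B t w)}}].

(* Independence of the sigma-algebras generated by the two processes, through
   their finite-dimensional cylinders. *)
Definition independent_processes (X Y : R -> {RV P >-> R}) : Prop :=
  forall (m n : nat) (s : 'I_m -> R) (t : 'I_n -> R)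
    (A : 'I_m -> set R) (C : 'I_n -> set R),
    (forall i, 0 <= s i) -> (forall j, 0 <= t j) ->
    (forall i, measurable (A i)) -> (forall j, measurable (C j)) ->
    let EX := \bigcap_(i in [set: 'I_m]) (X (s i) @^-1` A i) in
    let EY := \bigcap_(j in [set: 'I_n]) (Y (t j) @^-1` C j) in
    P (EX `&` EY) = (P EX * P EY)%E.

Definition is_density (X : {RV P >-> R}) (f : R -> R) : Prop :=
  [/\ measurable_fun [set: R] f, (forall x, 0 <= f x) &
      forall A : set R, measurable A ->
        P (X @^-1` A) = (\int[lebesgue_measure]_(x in A) (f x)%:E)%E].

(* [r(., 0) = delta]: the law at time [0] is the Dirac mass at [0], and the
   densities converge weakly to it as [t] decreases to [0]. *)
Definition initial_delta (Z : R -> {RV P >-> R}) (r : R -> R -> R) : Prop :=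
  (forall A : set R, measurable A -> P (Z 0 @^-1` A) = \d_(0 : R) A) /\
  forall phi : R -> R, continuous phi -> (exists M, forall x, `|phi x| <= M) ->
    \int[lebesgue_measure]_(x in [set: R]) (r x t * phi x) @[t --> 0^'+]
      --> phi 0.

End stochastic_processes.

Section fractional_operator.
Context (R : realType).

Definition gbinom (alpha : R) (i : nat) : R :=
  (\prod_(j < i) (alpha - j%:R)) / i`!%:R.

Definition frac_symbol (lambda alpha xi : R) : R :=
  (lambda + xi ^+ 2) `^ alpha.

Definition fourier_cos (f : R -> R) (xi : R) : R :=
  \int[lebesgue_measure]_(y in [set: R]) (f y * cos (xi * y)).

Definition fourier_sin (f : R -> R) (xi : R) : R :=
  \int[lebesgue_measure]_(y in [set: R]) (f y * sin (xi * y)).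

(* [(lambda - d^2/dx^2)^alpha f].  Fourier inversion writes [f] as a
   superposition of plane waves.  On a plane wave of frequency [xi] the
   binomial expansion
     [\sum_i binom(alpha, i) lambda^(alpha - i) (- d^2/dx^2)^i]
   converges for [xi ^+ 2 < lambda] and multiplies by [frac_symbol] (lemma
   [frac_symbol_binomial] below); [frac_symbol] is the analytic continuation
   of this sum to all frequencies.  The expansion cannot be applied to [f]
   itself: for a density whose characteristic function decays like
   [exp (- t |xi|^(2 alpha))], [alpha < 1], the derivatives of order [2 i] at
   [0] grow like [(i!)^(1/alpha)] and the series diverges.
   The integral is the real form of
     [(2 pi)^-1 \int frac_symbol(xi) \hat{f}(xi) e^(i xi x) dxi],
   valid because [frac_symbol] is real and even. *)
Definition frac_op (lambda alpha : R) (f : R -> R) (x : R) : R :=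
  (2 * pi)^-1 * \int[lebesgue_measure]_(xi in [set: R])
    (frac_symbol lambda alpha xi *
      (fourier_cos f xi * cos (xi * x) + fourier_sin f xi * sin (xi * x))).

(* Absolute convergence of every integral in [frac_op]; needed because the
   integral is total, with a junk value on non-integrable functions. *)
Definition frac_dom (lambda alpha : R) (f : R -> R) : Prop :=
  [/\ lebesgue_measure.-integrable [set: R] (EFin \o f),
      lebesgue_measure.-integrable [set: R]
        (fun xi => (frac_symbol lambda alpha xi * fourier_cos f xi)%:E) &
      lebesgue_measure.-integrable [set: R]
        (fun xi => (frac_symbol lambda alpha xi * fourier_sin f xi)%:E)].

Lemma gbinom0 (alpha : R) : gbinom alpha 0 = 1.
Proof. by rewrite /gbinom big_ord0 fact0 divr1. Qed.
Lemma gbinomS (alpha : R) i :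
  i.+1%:R * gbinom alpha i.+1 = (alpha - i%:R) * gbinom alpha i.
Proof.
rewrite /gbinom big_ord_recr/= factS natrM invfM mulrCA !mulrA.
set F := (i`!%:R)^-1; set p := \prod_(_ < _) _.
have e : (i.+1%:R : R) * i.+1%:R^-1 = 1 by rewrite divff ?pnatr_eq0.
by rewrite -[LHS]mul1r; transitivity ((i.+1%:R * i.+1%:R^-1) * (p * (alpha - i%:R) * F)); [ring|rewrite e; ring].
Qed.

Lemma gbinom_norm_le1 (alpha : R) i : 0 < alpha < 1 ->
  `|gbinom alpha i| <= 1 /\ `|(alpha - i%:R) * gbinom alpha i| <= 1.
Proof.
move=> /andP[a0 a1]; elim: i => [|i [IH1 IH2]].
  rewrite gbinom0 subr0 mulr1 normr1 gtr0_norm//; split=> //; exact: ltW.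
have i1 : (0 : R) < i.+1%:R by rewrite ltr0n.
have E : `|gbinom alpha i.+1| = `|(alpha - i%:R) * gbinom alpha i| / i.+1%:R.
  apply: (@mulfI _ i.+1%:R); first by rewrite gt_eqF.
  by rewrite [RHS]mulrC divfK ?pnatr_eq0// -gbinomS [RHS]normrM normr_nat.
have i1' : (1 : R) <= i.+1%:R by rewrite ler1n.
split; first by rewrite E ler_pdivrMr// mul1r (le_trans IH2).
rewrite [leLHS]normrM E mulrCA mulr_ile1// ?mulr_ge0 ?invr_ge0 ?(ltW i1)//.
rewrite ler_pdivrMr// mul1r ler0_norm; last lra.
by rewrite opprB; lra.
Qed.

Lemma cvg_pseries_le1 (f : nat -> R) (K : R) :
  (forall i, `|f i| <= i.+1%:R) -> 0 < K < 1 -> cvgn (pseries f K).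
Proof.
move=> fi /andP[K0 K1]; apply: normed_cvg.
pose s := Num.sqrt K.
have s0 : 0 < s by rewrite sqrtr_gt0.
have s1 : s < 1 by rewrite -sqrtr1 ltr_sqrt.
have ss : s * s = K by rewrite -expr2 sqr_sqrtr// ltW.
pose h := s^-1 - 1.
have h0 : 0 < h by rewrite subr_gt0 invf_gt1.
have B i : i.+1%:R * s ^+ i <= 1 + h^-1.
  have H : 1 + h *+ i <= (1 + h) ^+ i.
    elim: i => [|i IH]; first by rewrite mulr0n addr0 expr0.
    rewrite exprS (@le_trans _ _ ((1 + h) * (1 + h *+ i)))//; last first.
      by rewrite ler_wpM2l// addr_ge0// ltW.
    rewrite -[h *+ i.+1]mulr_natr -[h *+ i]mulr_natr -natr1.
    have : 0 <= h * h * i%:R by rewrite !mulr_ge0// ltW.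
    have -> : (1 + h) * (1 + h * i%:R) = 1 + h * (i%:R + 1) + h * h * i%:R by ring.
    lra.
  rewrite (_ : 1 + h = s^-1) in H; last by rewrite /h; ring.
  rewrite -[s]invrK exprVn ler_pdivrMr ?exprn_gt0 ?invr_gt0//.
  apply: (@le_trans _ _ ((1 + h^-1) * (1 + h *+ i))); last first.
    by rewrite ler_wpM2l// addr_ge0// invr_ge0 ltW.
  rewrite -[h *+ i]mulr_natr mulrDl mul1r mulrDr mulr1 mulrA mulVf ?gt_eqF// mul1r.
  rewrite -natr1; have := ler0n R i; have : 0 < h^-1 by rewrite invr_gt0.
  have : 0 <= h * i%:R by rewrite mulr_ge0// ltW.
  lra.
apply: (@series_le_cvg _ _ (geometric (1 + h^-1) s)).
- by move=> n; rewrite normr_ge0.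
- by move=> n /=; rewrite mulr_ge0 ?exprn_ge0 ?addr_ge0 ?invr_ge0// ltW.
- move=> n /=; rewrite normrM normrX (gtr0_norm K0) -ss exprMn mulrA.
  rewrite ler_wpM2r ?exprn_ge0 ?(ltW s0)//.
  by rewrite (le_trans _ (B n))// ler_wpM2r// exprn_ge0// ltW.
- by apply: is_cvg_geometric_series; rewrite gtr0_norm.
Qed.

Lemma cvg_gbinom (alpha x : R) : 0 < alpha < 1 -> `|x| < 1 ->
  series (fun i => gbinom alpha i * x ^+ i) @ \oo --> (1 + x) `^ alpha.
Proof.
move=> ha.
pose c := gbinom alpha; pose dc := pseries_diffs c.
have dcE i : dc i = (alpha - i%:R) * c i by rewrite /dc /pseries_diffs gbinomS.
have C1 (K : R) : 0 < K < 1 -> cvgn (pseries c K).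
  move=> HK; apply: cvg_pseries_le1 => // i.
  by rewrite (le_trans (@gbinom_norm_le1 alpha _ ha).1)// ler1n.
have C2 (K : R) : 0 < K < 1 -> cvgn (pseries dc K).
  move=> HK; apply: cvg_pseries_le1 => // i; rewrite dcE.
  by rewrite (le_trans (@gbinom_norm_le1 alpha _ ha).2)// ler1n.
have C3 (K : R) : 0 < K < 1 -> cvgn (pseries (pseries_diffs dc) K).
  move=> HK; apply: cvg_pseries_le1 => // i.
  rewrite /pseries_diffs dcE normrM normr_nat ler_piMr//.
  exact: (@gbinom_norm_le1 alpha _ ha).2.
pose h (x : R) : R := limn (pseries c x); pose k (x : R) : R := limn (pseries dc x).
have mid (y : R) : `|y| < 1 -> exists2 K, 0 < K < 1 & `|y| < `|K|.
  move=> y1; exists ((`|y| + 1) / 2); first by have := normr_ge0 y; lra.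
  by rewrite [ltRHS]gtr0_norm; have := normr_ge0 y; lra.
have Dh (y : R) : `|y| < 1 -> is_derive y 1 h (k y).
  move=> /mid[K HK yK]; apply: (@pseries_snd_diffs _ _ K) => //;
    [exact: C1|exact: C2|exact: C3].
have cvgc (y : R) : `|y| < 1 -> cvgn (pseries c y).
  by move=> /mid[K HK yK]; apply: is_cvg_pseries_inside yK; exact: C1.
have cvgdc (y : R) : `|y| < 1 -> cvgn (pseries dc y).
  by move=> /mid[K HK yK]; apply: is_cvg_pseries_inside yK; exact: C2.
have ode (y : R) : `|y| < 1 -> (1 + y) * k y = alpha * h y.
  move=> y1.
  have H1 := pseries_diffs_equiv (cvgdc _ y1).
  have H2 : series (fun i => dc i * y ^+ i + y * (i%:R * c i * y ^+ i.-1))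
      @ \oo --> k y + y * k y.
    rewrite (_ : series _ =
      pseries dc y + y \*: series (fun i => i%:R * c i * y ^+ i.-1)).
      apply: cvgD; first exact: cvgdc.
      by apply: cvgZl_tmp; exact: H1.
    by apply/funext => n; rewrite /pseries /series/= !fctE/= big_split/= scaler_sumr.
  have H3 : series (fun i => dc i * y ^+ i + y * (i%:R * c i * y ^+ i.-1))
      @ \oo --> alpha * h y.
    rewrite (_ : series _ = alpha \*: pseries c y).
      by apply: cvgZl_tmp; exact: cvgc.
    apply/funext => n; rewrite /pseries /series/= scaler_sumr.
    apply: eq_bigr => i _; rewrite dcE /GRing.scale/=.
    by case: i => [|i]/=; rewrite ?exprS; ring.
  by rewrite mulrDl mul1r; exact: (cvg_unique _ H2 H3).
pose g (y : R) : R := h y * (1 + y) `^ (- alpha).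
have Dg (y : R) : `|y| < 1 -> is_derive y 1 g 0.
  move=> y1; have y0 : 0 < 1 + y by move: y1; rewrite ltr_norml; lra.
  have D1 : is_derive y 1 (fun z => (1 + z) `^ (- alpha))
      (- alpha * (1 + y) `^ (- alpha - 1)).
    rewrite -[X in is_derive _ _ _ X]mulr1.
    apply: (@is_derive1_comp _ (fun z => z `^ (- alpha)) (fun z => 1 + z)).
      exact: is_derive1_powR.
    by rewrite -[X in is_derive _ _ _ X]add0r; apply: is_deriveD.
  have D2 := is_deriveM (Dh _ y1) D1.
  apply: is_derive_eq D2 _; rewrite /GRing.scale/=.
  rewrite [_ `^ (- alpha)](_ : _ = (1 + y) * (1 + y) `^ (- alpha - 1)).
    rewrite [_ * k y](_ : _ = (1 + y) * k y * (1 + y) `^ (- alpha - 1)); last by ring.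
    by rewrite ode//; ring.
  rewrite -{2}[1 + y]powRr1 ?ltW// -powRD; last by rewrite (gt_eqF y0) implybT.
  by congr (_ `^ _); ring.
move=> x1.
have h0 : h 0 = 1.
  rewrite /h; apply: cvg_lim => //; rewrite -(cvg_shiftS (pseries c 0)).
  rewrite (_ : (fun n => _) = cst 1); first exact: cvg_cst.
  apply/funext => n; rewrite /pseries /series/= big_nat_recl//= big1.
    by rewrite /c gbinom0 expr0 mulr1 addr0.
  by move=> i _; rewrite exprS mul0r mulr0.
have g0 : g 0 = 1 by rewrite /g h0 addr0 powR1 mul1r.
have cg (a b : R) : -1 < a -> b < 1 -> {within `[a, b], continuous g}.
  move=> a1 b1; apply: derivable_within_continuous => z.
  rewrite in_itv/= => /andP[az zb]; apply: ex_derive.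
  by apply: Dg; rewrite ltr_norml; apply/andP; split; lra.
have gx : g x = 1.
  have xb : -1 < x < 1 by rewrite -ltr_norml.
  have [||x0] := ltgtP x 0; last by rewrite x0.
  - move=> x0; have [||z zx] := @MVT _ g (fun=> 0) x 0 x0.
    + move=> z; rewrite in_itv/= => /andP[az zb].
      by apply: Dg; rewrite ltr_norml; apply/andP; split; lra.
    + by apply: cg; lra.
    + by rewrite mul0r g0; lra.
  - move=> x0; have [||z zx] := @MVT _ g (fun=> 0) 0 x x0.
    + move=> z; rewrite in_itv/= => /andP[az zb].
      by apply: Dg; rewrite ltr_norml; apply/andP; split; lra.
    + by apply: cg; lra.
    + by rewrite mul0r g0; lra.
rewrite (_ : _ `^ _ = h x); first exact: cvgc.
have p0 : (1 + x) `^ alpha != 0.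
  by rewrite gt_eqF// powR_gt0//; move: x1; rewrite ltr_norml; lra.
by move: gx; rewrite /g powRN => /(canRL (divfK p0)) ->; rewrite mul1r.
Qed.

Lemma binomial_expansion (lambda alpha u : R) : 0 < alpha < 1 -> `|u| < lambda ->
  series (fun i => gbinom alpha i * lambda `^ (alpha - i%:R) * u ^+ i) @ \oo
    --> (lambda + u) `^ alpha.
Proof.
move=> ha ul; have l0 : 0 < lambda by rewrite (le_lt_trans _ ul).
have ul1 : `|u / lambda| < 1.
  by rewrite normrM normfV (gtr0_norm l0) ltr_pdivrMr// mul1r.
rewrite (_ : lambda + u = lambda * (1 + u / lambda)); last first.
  by rewrite mulrDr mulr1 mulrCA divff ?mulr1// gt_eqF.
have u1 : 0 <= 1 + u / lambda by move: ul1; rewrite ltr_norml; lra.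
rewrite powRM// ?ltW//.
rewrite (_ : series _ = lambda `^ alpha \*:
    series (fun i => gbinom alpha i * (u / lambda) ^+ i)).
  by apply: cvgZl_tmp; exact: cvg_gbinom.
apply/funext => n; rewrite /series/= scaler_sumr; apply: eq_bigr => i _.
rewrite powRB; last by rewrite (gt_eqF l0) implybT.
by rewrite powR_mulrn ?ltW// expr_div_n /GRing.scale/=; ring.
Qed.

Definition plane_wave (xi a b : R) (y : R) : R :=
  a * cos (xi * y) + b * sin (xi * y).

Lemma derive1_plane_wave (xi a b : R) :
  derive1 (plane_wave xi a b) = plane_wave xi (xi * b) (- xi * a).
Proof.
have Dl (x : R) : is_derive x 1 (fun y : R => xi * y) xi.
  by rewrite -[X in is_derive _ _ _ X]mulr1; apply: is_deriveZ.
apply/funext => x; rewrite derive1E.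
have Dc := is_derive1_comp (is_derive_cos (xi * x)) (Dl x).
have Ds := is_derive1_comp (is_derive_sin (xi * x)) (Dl x).
have D := is_deriveD (is_deriveZ a Dc) (is_deriveZ b Ds).
rewrite (_ : plane_wave xi a b = a \*: (cos \o [eta *%R xi]) +
  b \*: (sin \o [eta *%R xi]))//.
by move/@derive_val: D => ->; rewrite /GRing.scale/= /plane_wave; ring.
Qed.

Lemma derive1n_plane_wave (xi a b : R) i :
  derive1n i.*2 (plane_wave xi a b) =
  fun y => (-1) ^+ i * (xi ^+ 2) ^+ i * plane_wave xi a b y.
Proof.
elim: i => [|i IH]; first by apply/funext => y; rewrite derive1n0 !expr0 !mul1r.
rewrite doubleS !derive1nS IH.
set e := (-1) ^+ i * _.
rewrite (_ : (fun y => _) = plane_wave xi (e * a) (e * b)); last first.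
  by apply/funext => y; rewrite /plane_wave; ring.
rewrite !derive1_plane_wave; apply/funext => y.
by rewrite /plane_wave /e !exprS; ring.
Qed.

Lemma frac_symbol_binomial (lambda alpha xi a b x : R) :
  0 < alpha < 1 -> xi ^+ 2 < lambda ->
  series (fun i => gbinom alpha i * lambda `^ (alpha - i%:R) *
      ((-1) ^+ i * derive1n i.*2 (plane_wave xi a b) x)) @ \oo
    --> frac_symbol lambda alpha xi * plane_wave xi a b x.
Proof.
move=> ha hxi; have u0 : `|xi ^+ 2| < lambda by rewrite ger0_norm// sqr_ge0.
rewrite mulrC (_ : series _ = plane_wave xi a b x \*:
    series (fun i => gbinom alpha i * lambda `^ (alpha - i%:R) * (xi ^+ 2) ^+ i)).
  by apply: cvgZl_tmp; exact: binomial_expansion.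
apply/funext => n; rewrite /series/= scaler_sumr; apply: eq_bigr => i _.
rewrite derive1n_plane_wave /GRing.scale/=.
have : (-1) ^+ i * (-1) ^+ i = 1 :> R by rewrite -exprMn mulrNN mulr1 expr1n.
set e := (-1) ^+ i => ee.
transitivity ((e * e) * (gbinom alpha i * lambda `^ (alpha - i%:R) *
  (xi ^+ 2) ^+ i * plane_wave xi a b x)); first by ring.
by rewrite ee; ring.
Qed.

End fractional_operator.

(* Main.v *)
Require Import Defs.
From HB Require Import structures.
From mathcomp Require Import all_boot all_order all_algebra.
From mathcomp Require Import all_classical all_reals all_analysis.
From mathcomp Require Import measurable_realfun lebesgue_integral_under.
From mathcomp Require Import normal_distribution.
From mathcomp Require Import ring lra.

Import Order.TTheory GRing.Theory Num.Theory.
Import numFieldNormedType.Exports.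

Local Open Scope classical_set_scope.
Local Open Scope ring_scope.

(* The density is the mixture [r x t = E (heat (S t) x)] of Gaussian kernels.
   The bound [E exp (- s S_t) = exp (- t psi s) = O (s^-2)] gives [S_t > 0]
   almost surely and [E (1 / S_t) < oo], so that [r] is finite, differentiable
   in [x], and [r] and its [x]-derivative are [O (1 / |x|)].  Fubini's theorem
   applied to the Fourier transform of the heat kernel shows that [r (., t)]
   has Fourier transform [exp (- t psi (xi^2))] and is recovered from it by the
   inversion formula; differentiating that formula in [t] under the integral
   sign yields the equation.
   That [r (., t)] is the density of [B (S_t)] follows by replacing [S_t] with
   its upper approximations [(floor (n S_t) + 1) / n], where
   independence reduces to countably many fixed times.  Path continuity then
   bounds the law of [B (S_t)] on open sets by the mixture, and two probability
   measures ordered on open sets are equal. *)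

(** The exponent in [O (s^-2)] serves twice. It makes the integral of [E exp (- s S_t)] over [s],
    which is [E (1 / S_t)], finite; and with [s = xi^2] it leaves [(1 + xi^2)^-1] after
    multiplication by a symbol of growth [1 + xi^2]. The first inverse moment is a convenient rather
    than sharp choice: the peak of the kernel has order [S^(-1/2)], its [x]-derivative order
    [1 / S], and both are at most [1 + 1 / S]. The kernel at a nonpositive time is [0] and has no
    mass, so the analysis is carried out for a version of [S_t] that is positive everywhere.
    Measurability of [B (S_t)] is not among the assumptions; laws are taken for [Z], and [B] itself
    is only observed at countably many fixed times. Fourier analysis stays real: combinations of
    sine and cosine are stable under differentiation, and the transform of the density is even. *)

(* [x `^ (-1)] is the inverse for [0 <= x] only, hence the detour through the
   square in the proof. *)
Lemma measurable_funV {d} {T : measurableType d} {R : realType} (f : T -> R) :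
  measurable_fun setT f -> measurable_fun setT (fun x => (f x)^-1).
Proof.
move=> mf; rewrite (_ : (fun _ => _) = fun x => f x * (f x ^+ 2) `^ (-1)).
  apply: measurable_funM => //.
  apply: (@measurableT_comp _ _ _ _ _ _ (fun x : R => x `^ (-1))).
    exact: measurable_powR.
  exact: measurable_funX.
apply/funext => x; have [->|fx0] := eqVneq (f x) 0; first by rewrite invr0 mul0r.
by rewrite powR_inv1 ?sqr_ge0// expr2 invfM mulrA divff// mul1r.
Qed.

(** * Dominated differentiation and Fubini for real-valued integrals *)

Section calculus.
Context {R : realType}.
Let mu := @lebesgue_measure R.

(** The majorant left when a symbol of size [1 + xi^2] meets decay [(1 + xi^2)^-2]; it also bounds
    the Laplace integral that gives the inverse moment. *)
Lemma integrable_oneDsqrV :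
  mu.-integrable setT (fun x : R => ((1 + x ^+ 2)^-1)%:E).
Proof.
have c : continuous (fun x : R => (oneDsqr x)^-1) by exact: continuous_oneDsqrV.
apply/integrableP; split.
  by apply/measurable_EFinP; exact: continuous_measurable_fun c.
under eq_integral.
  move=> x _; rewrite /= ger0_norm; last first.
    by rewrite invr_ge0 addr_ge0// sqr_ge0.
  over.
rewrite -/mu ge0_symfun_integralT//=.
- rewrite (_ : [set x | _] = `[0, +oo[%classic); last first.
    by apply/seteqP; split => x/=; rewrite in_itv/= andbT.
  by rewrite integral0y_oneDsqr -EFinM ltry.
- by move=> x; rewrite invr_ge0 addr_ge0// sqr_ge0.
- by move=> x /=; rewrite sqrrN.
Qed.

End calculus.

Section derive_under.
Context {R : realType} d {Y : measurableType d} (mu : {measure set Y -> \bar R}).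

(** Domination is asked only on a window []u, v[] around [a], because the bounds used for the time
    derivative degenerate as the time tends to [0]. *)
Lemma is_derive_under_integral (f df : R -> Y -> R) (G : Y -> R) (a u v : R) :
  u < a < v ->
  (forall x, u < x < v -> mu.-integrable setT (EFin \o f x)) ->
  (forall x y, u < x < v -> is_derive x 1 (f ^~ y) (df x y)) ->
  mu.-integrable setT (EFin \o G) ->
  (forall x y, u < x < v -> `|df x y| <= G y) ->
  is_derive a 1 (fun x => \int[mu]_y f x y) (\int[mu]_y df a y).
Proof.
move=> auv intf derf intG ub.
have E x y : u < x < v -> partial1of2 f x y = df x y.
  by move=> xuv; rewrite partial1of2E; case: (derf x y xuv).
have G0 y : 0 <= G y by apply: le_trans (ub a y auv).
have inI x : `]u, v[%classic x -> u < x < v by rewrite /= in_itv.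
have I1 x : `]u, v[%classic x -> mu.-integrable setT (EFin \o f x).
  by move/inI/intf.
have I2 x y : `]u, v[%classic x -> setT y -> derivable (f ^~ y) x 1.
  by move=> /inI xI _; case: (derf x y xI).
have I3 x y : `]u, v[%classic x -> setT y -> `|partial1of2 f x y| <= G y.
  by move=> /inI xI _; rewrite E//; exact: ub.
have Ia : `]u, v[%classic a by rewrite /= in_itv.
have := @derivable_under_integral R d Y mu f setT measurableT a u v Ia I1 I2
  G G0 intG I3.
have := @differentiation_under_integral R d Y mu f setT measurableT a u v Ia I1 I2
  G G0 intG I3.
rewrite derive1E => D1 D2; apply: DeriveDef => //.
by rewrite D1; apply: eq_Rintegral => y _; rewrite -E.
Qed.

End derive_under.

Section Rfubini.
Context d1 d2 (T1 : measurableType d1) (T2 : measurableType d2) (R : realType).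
Variable m1 : {sigma_finite_measure set T1 -> \bar R}.
Variable m2 : {sigma_finite_measure set T2 -> \bar R}.
Variable f : T1 -> T2 -> R.
Hypothesis mf : measurable_fun setT (fun z : T1 * T2 => f z.1 z.2).
Hypothesis f1 : forall x, m2.-integrable setT (fun y => (f x y)%:E).
Hypothesis f2 : forall y, m1.-integrable setT (fun x => (f x y)%:E).
Hypothesis foo : (\int[m1]_x \int[m2]_y `|f x y|%:E < +oo)%E.

Let imf : (m1 \x m2)%E.-integrable setT (fun z => (f z.1 z.2)%:E).
Proof. by apply/integrable12ltyP => //; exact/measurable_EFinP. Qed.

(** Integrability for every parameter, not just almost every one, makes each inner integral finite,
    so that the [fine] in a real-valued integral can be undone pointwise. *)
Let GE : (fun y => (\int[m1]_x f x y)%:E) =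
  fubini_G m1 (fun z => (f z.1 z.2)%:E).
Proof. by apply/funext => y; rewrite fineK//; exact: integrable_fin_num. Qed.

Let FE : (fun x => (\int[m2]_y f x y)%:E) =
  fubini_F m2 (fun z => (f z.1 z.2)%:E).
Proof. by apply/funext => x; rewrite fineK//; exact: integrable_fin_num. Qed.

Lemma integrable_Rintegral2 :
  m2.-integrable setT (fun y => (\int[m1]_x f x y)%:E).
Proof.
have := @integrable21ltyP _ _ _ _ _ m1 m2 _ (measurable_int _ imf).
move=> /iffLR/(_ imf) H; apply/integrableP; split.
  by rewrite GE; exact: measurable_fubini_G imf.
apply: le_lt_trans H; apply: ge0_le_integral => //.
- by apply: measurableT_comp => //; rewrite GE; exact: measurable_fubini_G imf.
- apply: (@measurable_fun_fubini_tonelli_G _ _ _ _ _ m1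
    (fun z => `|(f z.1 z.2)%:E|%E)) => //.
  by apply: measurableT_comp => //; exact/measurable_EFinP.
- move=> y _; rewrite (congr1 (fun h => h y) GE).
  by apply: le_abse_integral => //; exact: measurable_int (f2 y).
Qed.

Lemma RFubini : \int[m1]_x (\int[m2]_y f x y) = \int[m2]_y (\int[m1]_x f x y).
Proof. by rewrite /(Rintegral m1) /(Rintegral m2) FE GE (Fubini imf). Qed.

End Rfubini.

(** * Heat kernel *)

Section heat_kernel.
Context {R : realType}.
Local Notation mu := (@lebesgue_measure R).
Implicit Types s x xi a b : R.

(** The fundamental theorem of calculus on [[-(n+1), n+1]], then dominated convergence with majorant
    [|f|]; limits of [F] along the integers are enough. *)
Lemma integral_derive_eq0 (F f : R -> R) :
  (forall x, is_derive x 1 F (f x)) -> continuous f ->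
  mu.-integrable setT (EFin \o f) ->
  F n%:R @[n --> \oo] --> 0 -> F (- n%:R) @[n --> \oo] --> 0 ->
  \int[mu]_x f x = 0.
Proof.
move=> dF cf intf Fy FNy.
have cF : continuous F.
  by move=> x; apply: differentiable_continuous; apply/derivable1_diffP; case: (dF x).
(* The successor keeps every interval nondegenerate, as the fundamental theorem requires. *)
pose I n : set R := `[(- n.+1%:R), n.+1%:R]%classic.
have mfI n : measurable_fun setT (EFin \o (f \_ (I n))).
  apply/measurable_EFinP/measurable_restrict => //; first exact: measurable_itv.
  by rewrite setTI; apply: measurable_funTS; exact: continuous_measurable_fun.
have [||||_ _] := @dominated_convergence _ _ R mu setT measurableT
  (fun n => EFin \o (f \_ (I n))) (EFin \o f) (abse \o (EFin \o f)) mfI.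
- exact: measurable_int intf.
- apply: aeW => x _; apply: cvg_near_cst.
  exists (Num.truncn `|x|) => // n /= xn; rewrite /patch mem_set// /I/= in_itv/= -ler_norml.
  by rewrite (le_trans (ltW (truncnS_gt _)))// ler_nat.
- exact: integrable_abse.
- apply: aeW => x n _ /=; rewrite /patch; case: ifPn => // _.
  by rewrite normr0 lee_fin.
rewrite [X in X @ _ --> _](_ : _ = fun n => (F n.+1%:R - F (- n.+1%:R))%:E).
  move=> H; have : fine (F n.+1%:R - F (- n.+1%:R))%:E @[n --> \oo] -->
      \int[mu]_x f x.
    by apply: fine_cvg; rewrite fineK//; exact: integrable_fin_num.
  move=> /= H1; apply: cvg_unique H1 _ => //.
  rewrite -(subr0 (0 : R)); apply: cvgB.
    by rewrite (cvg_shiftS (fun n => F n%:R)).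
  by rewrite (cvg_shiftS (fun n => F (- n%:R))).
apply/funext => n /=; rewrite EFinB.
transitivity (\int[mu]_(x in I n) (f x)%:E)%E.
  rewrite [RHS]integral_mkcond; apply: eq_integral => x _.
  by rewrite /patch; case: ifP.
rewrite (@continuous_FTC2 _ f F)//.
- by rewrite (@lt_trans _ _ 0)// ?oppr_lt0 ltr0n.
- exact: continuous_subspaceT.
- split.
  + by move=> x _; case: (dF x).
  + by apply: cvg_at_right_filter; exact: cF.
  + by apply: cvg_at_left_filter; exact: cF.
- by move=> x _; rewrite derive1E; case: (dF x).
Qed.

(* For [s <= 0] the square root is [0] and so is [heat s x]. *)
Definition heat s x : R := expR (- (x ^+ 2 / (4 * s))) / Num.sqrt (4 * pi * s).

Definition dheat s x : R := - (x / (2 * s)) * heat s x.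

Lemma heat_le0 s x : s <= 0 -> heat s x = 0.
Proof.
move=> s0; rewrite /heat ler0_sqrtr ?invr0 ?mulr0//.
by rewrite mulr_ge0_le0// mulr_ge0// pi_ge0.
Qed.

Lemma heat_ge0 s x : 0 <= heat s x.
Proof. by rewrite mulr_ge0 ?expR_ge0// invr_ge0. Qed.

Lemma heat_normal_pdf s x : 0 < s -> heat s x = normal_pdf 0 (Num.sqrt (2 * s)) x.
Proof.
move=> s0; have s20 : 0 < 2 * s by rewrite mulr_gt0.
rewrite normal_pdfE ?gt_eqF ?sqrtr_gt0//.
rewrite /heat /normal_peak /normal_fun subr0 sqr_sqrtr ?ltW// mulrC; congr (_ * _).
  by congr (_^-1); congr (Num.sqrt _); rewrite -mulr_natr; ring.
by congr expR; rewrite mulNr -mulr_natr; congr (- (_ / _)); ring.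
Qed.

Lemma measurable_heat2 : measurable_fun setT (fun z : R * R => heat z.1 z.2).
Proof.
apply: measurable_funM.
  apply: measurableT_comp => //; apply: measurableT_comp => //.
  apply: measurable_funM; first exact: measurable_funX.
  by apply: measurable_funV; apply: measurable_funM.
apply: measurable_funV; apply: measurableT_comp.
  by apply: continuous_measurable_fun; exact: sqrt_continuous.
exact: measurable_funM.
Qed.

Lemma measurable_heat s : measurable_fun setT (heat s).
Proof.
exact: (@measurable_fun_pair2 _ _ _ _ _ _ _ s measurable_heat2).
Qed.

Lemma is_derive_heat s x : is_derive x 1 (heat s) (dheat s x).
Proof.
have D1 : is_derive x 1 (fun y : R => - (y ^+ 2 / (4 * s))) (- (x / (2 * s))).
  have D := is_deriveN (is_deriveZ (4 * s)^-1 (is_deriveX 2 (is_derive_id x 1))).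
  rewrite (_ : (fun y => _) = - ((4 * s)^-1 \*: (id ^+ 2))); last first.
    by apply/funext => y /=; rewrite /GRing.scale/= fctE mulrC.
  apply: is_derive_eq D _; rewrite /GRing.scale/=.
  by rewrite !invfM; set t := s^-1; field.
have D2 := is_derive1_comp (is_derive_expR _) D1.
have D3 := is_deriveZ (Num.sqrt (4 * pi * s))^-1 D2.
rewrite (_ : heat s = (Num.sqrt (4 * pi * s))^-1 \*: (expR \o
  (fun y : R => - (y ^+ 2 / (4 * s))))); last first.
  by apply/funext => y; rewrite /heat mulrC.
by apply: is_derive_eq D3 _; rewrite /dheat /heat /GRing.scale/=; ring.
Qed.

Let mul_expRN_le1 (u : R) : u * expR (- u) <= 1.
Proof.
by rewrite expRN ler_pdivrMr ?expR_gt0// mul1r (le_trans _ (expR_ge1Dx u))// lerDr.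
Qed.

(** If [q = sqrt (4 pi s) < 1] then [q >= q^2 >= s]; otherwise [1 / q <= 1]. The true order
    [s^(-1/2)] is given up because [1 / S] is what will be integrated. *)
Lemma heat_peak_le s : 0 < s -> (Num.sqrt (4 * pi * s))^-1 <= 1 + s^-1.
Proof.
move=> s0; have p2 := @pi_ge2 R.
have s40 : s <= 4 * pi * s by rewrite ler_peMl ?ltW//; lra.
have q0 : 0 < Num.sqrt (4 * pi * s) by rewrite sqrtr_gt0 (lt_le_trans s0).
have [q1|q1] := leP 1 (Num.sqrt (4 * pi * s)).
  by rewrite (@le_trans _ _ 1) ?invf_le1// lerDl invr_ge0 ltW.
apply: (@le_trans _ _ s^-1); last by rewrite lerDr.
rewrite lef_pV2 ?posrE//.
rewrite (le_trans s40)// -{1}(sqr_sqrtr (le_trans (ltW s0) s40)) expr2.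
by rewrite ler_piMl// ltW.
Qed.

Lemma heat_le s x : 0 < s -> heat s x <= 1 + s^-1.
Proof.
move=> s0; apply: le_trans (heat_peak_le s s0).
rewrite /heat ler_piMl ?invr_ge0// -expR0 ler_expR oppr_le0.
by rewrite mulr_ge0 ?sqr_ge0// invr_ge0 mulr_ge0// ltW.
Qed.

(** The constant does not depend on [s]: the square of the left side is [v exp (- v) / (2 pi)] with
    [v = x^2 / (2 s)], and [v exp (- v) <= 1]. Mixing over [s] therefore preserves the decay in
    [x]. *)
Lemma normM_heat_le s x : `|x| * heat s x <= 1.
Proof.
have [s0|s0] := leP s 0; first by rewrite heat_le0// mulr0.
have p2 := @pi_ge2 R.
rewrite -(@ler_pXn2r _ 2) ?nnegrE// ?mulr_ge0 ?heat_ge0// expr1n.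
rewrite /heat !exprMn real_normK ?num_real// exprVn sqr_sqrtr; last first.
  by rewrite !mulr_ge0 ?ltW// (lt_le_trans _ p2).
rewrite -expRM_natl.
rewrite [leLHS](_ : _ = (x ^+ 2 / (2 * s)) * expR (- (x ^+ 2 / (2 * s))) / (2 * pi)).
  rewrite ler_pdivrMr ?mul1r; last lra.
  by rewrite (le_trans (mul_expRN_le1 _))//; lra.
rewrite (_ : 2%:R * - (x ^+ 2 / (4 * s)) = - (x ^+ 2 / (2 * s))).
  by field; rewrite !gt_eqF//; lra.
by field; rewrite gt_eqF.
Qed.

(** [normM_heat_le] absorbs the factor [x] of [dheat]. Being uniform in [x], the bound allows the
    mixture to be differentiated under the expectation. *)
Lemma dheat_le s x : 0 < s -> `|dheat s x| <= s^-1.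
Proof.
move=> s0; rewrite /dheat normrM normrN (ger0_norm (heat_ge0 _ _)) normrM.
rewrite mulrAC; apply: (@le_trans _ _ (1 * `|(2 * s)^-1|)).
  by rewrite ler_wpM2r// normM_heat_le.
rewrite mul1r gtr0_norm ?invr_gt0 ?mulr_gt0// lef_pV2 ?posrE ?mulr_gt0//.
lra.
Qed.

Lemma normM_dheat_le s x : 0 < s -> `|x| * `|dheat s x| <= 2 * (1 + s^-1).
Proof.
move=> s0; rewrite /dheat /heat !normrM normrN normrM.
have q0 : 0 < Num.sqrt (4 * pi * s) by rewrite sqrtr_gt0 !mulr_gt0// pi_gt0.
have t0 : 0 < (2 * s)^-1 by rewrite invr_gt0 mulr_gt0.
have q0' : 0 < (Num.sqrt (4 * pi * s))^-1 by rewrite invr_gt0.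
rewrite (gtr0_norm (expR_gt0 _)) (gtr0_norm t0) (gtr0_norm q0').
rewrite [leLHS](_ : _ = 2 * (x ^+ 2 / (4 * s) * expR (- (x ^+ 2 / (4 * s))) *
  (Num.sqrt (4 * pi * s))^-1)); last first.
  rewrite -[x ^+ 2]real_normK ?num_real//.
  set e := expR _; field; rewrite !gt_eqF//.
by rewrite ler_pM2l// (le_trans _ (heat_peak_le s s0))// ler_piMl ?invr_ge0.
Qed.

End heat_kernel.

(** * Fourier transform of the heat kernel *)

Section integrable_real.
Context d {T : measurableType d} {R : realType} (mu : {measure set T -> \bar R}).
Implicit Types f g : T -> R.

Lemma eq_integrableR f g : f =1 g ->
  mu.-integrable setT (fun x => (f x)%:E) -> mu.-integrable setT (fun x => (g x)%:E).
Proof. by move=> /funext ->. Qed.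

Lemma integrableZR k f : mu.-integrable setT (fun x => (f x)%:E) ->
  mu.-integrable setT (fun x => (k * f x)%:E).
Proof. by move=> /(integrableZl measurableT k). Qed.

Lemma integrableDR f g : mu.-integrable setT (fun x => (f x)%:E) ->
  mu.-integrable setT (fun x => (g x)%:E) ->
  mu.-integrable setT (fun x => (f x + g x)%:E).
Proof. by move=> /integrableD; apply. Qed.

Lemma le_integrableR f g : measurable_fun setT f ->
  mu.-integrable setT (fun x => (g x)%:E) -> (forall x, `|f x| <= g x) ->
  mu.-integrable setT (fun x => (f x)%:E).
Proof.
move=> mf ig fg; apply: le_integrable ig => //; first exact/measurable_EFinP.
by move=> x _ /=; rewrite lee_fin (le_trans (fg x))// ler_norm.
Qed.

End integrable_real.
Arguments eq_integrableR {d T R mu f g}.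
Arguments integrableZR {d T R mu} k {f}.
Arguments integrableDR {d T R mu f g}.
Arguments le_integrableR {d T R mu f g}.

Section gaussian_fourier.
Context {R : realType}.
Local Notation mu := (@lebesgue_measure R).
Implicit Types s x y xi a b : R.

Lemma integral_heat s : 0 < s -> (\int[mu]_x (heat s x)%:E = 1)%E.
Proof.
move=> s0; rewrite -(integral_normal_pdf 0 (Num.sqrt (2 * s))).
by apply: eq_integral => x _; rewrite heat_normal_pdf.
Qed.

Lemma integrable_heat s : 0 < s -> mu.-integrable setT (EFin \o heat s).
Proof.
move=> s0; apply: eq_integrable (integrable_normal_pdf 0 (Num.sqrt (2 * s))) => //.
by move=> x _; rewrite /= heat_normal_pdf.
Qed.

Lemma integrable_heatM s (g : R -> R) (M : R) : 0 < s ->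
  measurable_fun setT g -> (forall x, `|g x| <= M) ->
  mu.-integrable setT (fun x => (heat s x * g x)%:E).
Proof.
move=> s0 mg gM; have := @integrableMl _ _ _ mu setT measurableT (EFin \o heat s) g.
apply; [exact: integrable_heat|exact: mg|].
exists M; split; first exact: num_real.
by move=> y My x _ /=; rewrite (le_trans (gM x))// ltW.
Qed.

(** Half of the Gaussian exponent absorbs [|x|]; the other half is that of the kernel at time [2 s].
    With [v = x^2 / (8 s)], the bounds [|x| <= 1 + x^2 = 1 + 8 s v] and [v exp (- v) <= 1] give the
    factor [1 + 8 s]. *)
Lemma normM_heat_le_heat s : 0 < s ->
  exists2 C, 0 <= C & forall x, `|x| * heat s x <= C * heat (2 * s) x.
Proof.
move=> s0; have p0 := @pi_gt0 R.
have q0 : 0 < Num.sqrt (4 * pi * s) by rewrite sqrtr_gt0 !mulr_gt0.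
have q1 : 0 < Num.sqrt (4 * pi * (2 * s)) by rewrite sqrtr_gt0 !mulr_gt0.
exists ((1 + 8 * s) * Num.sqrt (4 * pi * (2 * s)) / Num.sqrt (4 * pi * s)).
  by rewrite !mulr_ge0 ?invr_ge0 ?(ltW q0) ?(ltW q1)// addr_ge0// mulr_ge0// ltW.
move=> x; pose v := x ^+ 2 / (8 * s).
have v0 : 0 <= v by rewrite mulr_ge0 ?sqr_ge0// invr_ge0 mulr_ge0// ltW.
rewrite /heat (_ : x ^+ 2 / (4 * s) = v + v); last first.
  by rewrite /v; field; rewrite gt_eqF.
rewrite (_ : x ^+ 2 / (4 * (2 * s)) = v); last first.
  by rewrite /v; field; rewrite gt_eqF.
rewrite [leRHS](_ : _ = (1 + 8 * s) * expR (- v) / Num.sqrt (4 * pi * s)); last first.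
  by set e := expR _; field; rewrite !gt_eqF.
rewrite mulrA ler_pM2r ?invr_gt0// opprD expRD mulrA ler_pM2r ?expR_gt0//.
have x1 : `|x| <= 1 + x ^+ 2.
  by rewrite -[x ^+ 2]real_normK ?num_real//; have := sqr_ge0 (`|x| - 1); rewrite sqrrB1 mulr2n;
    have := normr_ge0 x; lra.
have e1 : expR (- v) <= 1 by rewrite -expR0 ler_expR oppr_le0.
have e2 : v * expR (- v) <= 1.
  by rewrite expRN ler_pdivrMr ?expR_gt0// mul1r (le_trans _ (expR_ge1Dx v))// lerDr.
have xv : x ^+ 2 = 8 * s * v by rewrite /v; field; rewrite gt_eqF.
apply: le_trans (ler_wpM2r (expR_ge0 _) x1) _.
by rewrite mulrDl mul1r lerD// xv -(mulrA (8 * s)) ler_piMr// mulr_ge0// ltW.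
Qed.

Lemma is_derive_continuous (f df : R -> R) :
  (forall x, is_derive x 1 f (df x)) -> continuous f.
Proof.
move=> D x; apply: differentiable_continuous.
by apply/derivable1_diffP; case: (D x).
Qed.

Lemma cvg0_normM_le (g : R -> R) (K : R) : (forall x, `|x| * `|g x| <= K) ->
  g x @[x --> +oo] --> 0 /\ g x @[x --> -oo] --> 0.
Proof.
move=> gK.
have K0 : 0 <= K by rewrite (le_trans _ (gK 0))// normr0 mul0r.
have bnd e x : 0 < e -> K / e < `|x| -> `|0 - g x| <= e.
  move=> e0 xK; rewrite sub0r normrN.
  have x0 : 0 < `|x| by rewrite (le_lt_trans _ xK)// divr_ge0// ltW.
  rewrite -(ler_pM2l x0) (le_trans (gK x))// -ler_pdivrMr//; exact: ltW.
split; apply/cvgrPdist_le => e e0; near=> x; apply: bnd => //.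
  have x0 : 0 <= x by near: x; apply: nbhs_pinfty_ge; exact: num_real.
  rewrite ger0_norm//; near: x; apply: nbhs_pinfty_gt; exact: num_real.
have x0 : x <= 0 by near: x; apply: nbhs_ninfty_le; exact: num_real.
rewrite ler0_norm// ltrNr; near: x; apply: nbhs_ninfty_lt; exact: num_real.
Unshelve. all: by end_near. Qed.

Lemma measurable_plane_wave xi a b : measurable_fun setT (plane_wave xi a b).
Proof.
apply: measurable_funD; apply: measurable_funM => //;
  apply: continuous_measurable_fun => x.
  apply: continuous_comp; last exact: continuous_cos.
  by apply: cvgM; [exact: cvg_cst|exact: cvg_id].
apply: continuous_comp; last exact: continuous_sin.
by apply: cvgM; [exact: cvg_cst|exact: cvg_id].
Qed.

Lemma plane_wave_le xi a b y : `|plane_wave xi a b y| <= `|a| + `|b|.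
Proof.
rewrite (le_trans (ler_normD _ _))// !normrM lerD// ler_piMr//.
  exact: cos_max.
exact: sin_max.
Qed.

Lemma is_derive_plane_wave xi a b y : is_derive y 1 (plane_wave xi a b)
  (plane_wave xi (xi * b) (- xi * a) y).
Proof.
have Dl : is_derive y 1 (fun z : R => xi * z) xi.
  by rewrite -[X in is_derive _ _ _ X]mulr1; apply: is_deriveZ.
have Dc := is_derive1_comp (is_derive_cos (xi * y)) Dl.
have Ds := is_derive1_comp (is_derive_sin (xi * y)) Dl.
have D := is_deriveD (is_deriveZ a Dc) (is_deriveZ b Ds).
by apply: is_derive_eq D _; rewrite /GRing.scale/= /plane_wave; ring.
Qed.

(** The phase is symmetric in [xi] and [y], so this is [is_derive_plane_wave] with the two
    exchanged. *)
Lemma is_derive_plane_wave_freq xi a b y :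
  is_derive xi 1 (fun z => plane_wave z a b y) (y * plane_wave xi b (- a) y).
Proof.
rewrite (_ : (fun z => _) = plane_wave y a b); last first.
  by apply/funext => z; rewrite /plane_wave (mulrC z).
by apply: is_derive_eq (is_derive_plane_wave y a b xi) _;
  rewrite /plane_wave (mulrC y xi); ring.
Qed.

(** The classical differential equation for a Gaussian transform: differentiation in the frequency
    produces [y * heat s y = - 2 s * dheat s y], and integration by parts returns the original
    integral. Both [a] and [b] are carried because differentiation exchanges sine and cosine. *)
Let is_derive_fourier_heat s xi a b : 0 < s ->
  is_derive xi 1 (fun z => \int[mu]_y (heat s y * plane_wave z a b y))
    (- (2 * s * xi) * \int[mu]_y (heat s y * plane_wave xi a b y)).
Proof.
move=> s0; have [C C0 hC] := normM_heat_le_heat s s0.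
have s20 : 0 < 2 * s by rewrite mulr_gt0.
have i0 x c d : mu.-integrable setT (EFin \o (fun y => heat s y * plane_wave x c d y)).
  apply: integrable_heatM (measurable_plane_wave x c d) _ => //.
  exact: plane_wave_le.
have mi1 x c d : measurable_fun setT (fun y => heat s y * (y * plane_wave x c d y)).
  apply: measurable_funM; first exact: measurable_heat.
  by apply: measurable_funM => //; exact: measurable_plane_wave.
pose G (c d y : R) := (`|c| + `|d|) * (C * heat (2 * s) y).
have iG c d : mu.-integrable setT (EFin \o G c d).
  by apply: integrableZR; apply: integrableZR; exact: integrable_heat.
have le1 x c d y : `|heat s y * (y * plane_wave x c d y)| <= G c d y.
  rewrite mulrA normrM /G mulrC (mulrC (heat s y)) normrM (ger0_norm (heat_ge0 s y)).
  by rewrite ler_pM ?mulr_ge0 ?heat_ge0// plane_wave_le.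
have i1 x c d : mu.-integrable setT
    (EFin \o (fun y => heat s y * (y * plane_wave x c d y))).
  apply: (@le_integrableR _ _ _ mu _ (G c d)).
  - exact: mi1.
  - exact: iG.
  - exact: le1.
have D := @is_derive_under_integral _ _ _ mu
  (fun z y => heat s y * plane_wave z a b y)
  (fun z y => heat s y * (y * plane_wave z b (- a) y))
  (G b (- a)) xi (xi - 1) (xi + 1).
apply: is_derive_eq (D _ _ _ _ _) _ => //.
- by apply/andP; split; lra.
- move=> z y _; exact: is_deriveZ (is_derive_plane_wave_freq z a b y).
have id c d : mu.-integrable setT
    (EFin \o (fun y => dheat s y * plane_wave xi c d y)).
  apply: eq_integrableR (integrableZR (- (2 * s)^-1) (i1 xi c d)) => y.
  by rewrite /dheat; ring.
have idf : mu.-integrable setT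
    (EFin \o (fun y => dheat s y * plane_wave xi b (- a) y
    + heat s y * plane_wave xi (xi * (- a)) (- xi * b) y)).
  by apply: integrableDR; [exact: id|exact: i0].
have parts : \int[mu]_y (dheat s y * plane_wave xi b (- a) y
    + heat s y * plane_wave xi (xi * (- a)) (- xi * b) y) = 0.
  pose F y := heat s y * plane_wave xi b (- a) y.
  have [lim1 lim2] : F x @[x --> +oo] --> 0 /\ F x @[x --> -oo] --> 0.
    apply: (@cvg0_normM_le F (`|b| + `|- a|)) => y.
    rewrite /F normrM mulrA (ger0_norm (heat_ge0 s y)).
    rewrite -[leRHS]mul1r ler_pM ?plane_wave_le// ?normM_heat_le//.
    by rewrite mulr_ge0// heat_ge0.
  apply: (@integral_derive_eq0 _ F).
  - move=> y; have D1 := is_deriveM (is_derive_heat s y)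
      (is_derive_plane_wave xi b (- a) y).
    by apply: is_derive_eq D1 _; rewrite /GRing.scale/=; ring.
  - move=> y; apply: cvgD.
      apply: cvgM; last exact: is_derive_continuous (is_derive_plane_wave _ _ _) _.
      apply: cvgM; last exact: is_derive_continuous (is_derive_heat s) _.
      by apply: cvgN; apply: cvgM; [exact: cvg_id|exact: cvg_cst].
    apply: cvgM; first exact: is_derive_continuous (is_derive_heat s) _.
    exact: is_derive_continuous (is_derive_plane_wave _ _ _) _.
  - exact: idf.
  - by apply: (cvg_comp (fun n => n%:R) F) lim1; exact: cvgr_idn.
  - apply: (cvg_comp (fun n => - n%:R) F) lim2.
    apply/cvgNrNy; exact: cvgr_idn.
(* Isolates a total derivative, whose integral vanishes by [parts]; what remains is a multiple of
   the original integrand. *)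
transitivity (\int[mu]_y (- (2 * s) *
  (dheat s y * plane_wave xi b (- a) y +
    heat s y * plane_wave xi (xi * (- a)) (- xi * b) y)
  + - (2 * s * xi) * (heat s y * plane_wave xi a b y))).
  apply: eq_Rintegral => y _.
  by rewrite /dheat /plane_wave; field; rewrite gt_eqF.
rewrite RintegralD// ?RintegralZl// ?parts ?mulr0 ?add0r//.
- exact: integrableZR.
- by apply: integrableZR; exact: i0.
Qed.

(** [exp (s xi^2)] is an integrating factor for the preceding equation. At [xi = 0] the wave is the
    constant [a], which is why [b] drops out of the value. *)
Lemma fourier_heat s xi a b : 0 < s ->
  \int[mu]_y (heat s y * plane_wave xi a b y) = a * expR (- (s * xi ^+ 2)).
Proof.
move=> s0; pose phi xi := \int[mu]_y (heat s y * plane_wave xi a b y).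
have D x : is_derive x 1 (fun z => phi z * expR (s * z ^+ 2)) 0.
  have D1 : is_derive x 1 (fun z : R => s * z ^+ 2) (2 * s * x).
    have D := is_deriveZ s (is_deriveX 2 (is_derive_id x 1)).
    by apply: is_derive_eq D _; rewrite /GRing.scale/=; ring.
  have D2 := is_derive1_comp (is_derive_expR _) D1.
  have D3 := is_deriveM (is_derive_fourier_heat s x a b s0) D2.
  by apply: is_derive_eq D3 _; rewrite /GRing.scale/= /phi; ring.
have := is_derive_0_is_cst xi 0 D.
rewrite expr0n/= mulr0 expR0 mulr1 (_ : phi 0 = a); last first.
  transitivity (\int[mu]_y (a * heat s y)).
    by apply: eq_Rintegral => y _; rewrite /plane_wave mul0r cos0 sin0; ring.
  rewrite RintegralZl//; last exact: integrable_heat.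
  by rewrite /Rintegral integral_heat//= mulr1.
by move=> E; rewrite -/(phi xi) -[X in _ = X * _]E -mulrA -expRD subrr expR0 mulr1.
Qed.

(** A Gaussian in the frequency is, up to a factor, a heat kernel at time [1 / (4 s)]; inversion is
    then [fourier_heat] again, with [x] in the role of the frequency. *)
Lemma expR_heat s xi : 0 < s ->
  expR (- (s * xi ^+ 2)) = Num.sqrt (pi / s) * heat (4 * s)^-1 xi.
Proof.
move=> s0; rewrite /heat.
rewrite (_ : 4 * pi * (4 * s)^-1 = pi / s); last by field; rewrite gt_eqF.
rewrite (_ : xi ^+ 2 / (4 / (4 * s)) = s * xi ^+ 2); last by field; rewrite gt_eqF.
by rewrite [RHS]mulrCA divff ?mulr1// gt_eqF// sqrtr_gt0 divr_gt0// pi_gt0.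
Qed.

Lemma inverse_fourier_heat s x : 0 < s ->
  (2 * pi)^-1 * \int[mu]_xi (expR (- (s * xi ^+ 2)) * cos (xi * x)) = heat s x.
Proof.
move=> s0; have p0 := @pi_gt0 R.
have s40 : 0 < (4 * s)^-1 by rewrite invr_gt0 mulr_gt0.
transitivity ((2 * pi)^-1 * \int[mu]_xi (Num.sqrt (pi / s) *
    (heat (4 * s)^-1 xi * plane_wave x 1 0 xi))).
  congr (_ * _); apply: eq_Rintegral => xi _.
  by rewrite expR_heat// /plane_wave (mulrC xi); ring.
rewrite RintegralZl//; last first.
  apply: integrable_heatM (measurable_plane_wave x 1 0) _ => //.
  exact: plane_wave_le.
rewrite fourier_heat// mul1r /heat mulrA [in LHS]mulrC; congr (_ * _).
  by congr (expR (- _)); field; rewrite gt_eqF.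
have q0 : 0 < Num.sqrt (4 * pi * s) by rewrite sqrtr_gt0 !mulr_gt0.
apply: (@mulIf _ (2 * pi * Num.sqrt (4 * pi * s))).
  by rewrite gt_eqF// !mulr_gt0.
rewrite mulrACA mulVf ?gt_eqF ?mulr_gt0// mul1r mulrCA mulVf ?gt_eqF// mulr1.
rewrite -sqrtrM ?divr_ge0 ?ltW// (_ : pi / s * _ = (2 * pi) ^+ 2); last first.
  by field; rewrite gt_eqF.
by rewrite sqrtr_sqr ger0_norm// ltW// mulr_gt0.
Qed.

End gaussian_fourier.

(** * Gaussian mixtures *)

Lemma lty_integral_dom d1 d2 (T1 : measurableType d1) (T2 : measurableType d2)
    (R : realType) (m1 : {sigma_finite_measure set T1 -> \bar R})
    (m2 : {sigma_finite_measure set T2 -> \bar R}) (f : T1 -> T2 -> R) (G : T1 -> R) :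
  measurable_fun setT (fun z : T1 * T2 => f z.1 z.2) ->
  m1.-integrable setT (fun x => (G x)%:E) ->
  (forall x, (\int[m2]_y `|f x y|%:E <= (G x)%:E)%E) ->
  (\int[m1]_x \int[m2]_y `|f x y|%:E < +oo)%E.
Proof.
move=> mf iG fG; apply: le_lt_trans (integrable_lty measurableT iG).
apply: ge0_le_integral => //.
- by move=> x _; exact: integral_ge0.
- apply: (@measurable_fun_fubini_tonelli_F _ _ _ _ _ m2
    (fun z => `|(f z.1 z.2)|%:E)) => //.
  by apply/measurable_EFinP; exact: measurableT_comp.
- exact: measurable_int iG.
Qed.

Lemma Rintegral_cst_probability {d} {T : measurableType d} {R : realType}
  (P : probability T R) (k : R) : \int[P]_w k = k.
Proof.
rewrite /Rintegral integral_cst//; transitivity (fine (k%:E * 1%:E)%E).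
  by congr (fine (_ * _)%E); exact: probability_setT.
by rewrite mule1.
Qed.

Section heat_mixture.
Context {R : realType} {d} {T : measurableType d} (P : probability T R).
Local Notation mu := (@lebesgue_measure R).
Variable X : T -> R.
Hypothesis mX : measurable_fun setT X.
Hypothesis X0 : forall w, 0 < X w.
Hypothesis iX : P.-integrable setT (fun w => (X w)^-1%:E).

Definition heat_mix (x : R) : R := \int[P]_w heat (X w) x.

Lemma integrable_cstP (k : R) : P.-integrable setT (fun=> k%:E).
Proof. exact: finite_measure_integrable_cst. Qed.

Lemma measurable_heatX2 : measurable_fun setT (fun z : T * R => heat (X z.1) z.2).
Proof.
have m : measurable_fun setT (fun z : T * R => (X z.1, z.2)).
  by apply: measurable_fun_pair => //; exact: measurableT_comp.
exact: (@measurableT_comp _ _ _ _ _ _ (fun z : R * R => heat z.1 z.2) _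
  (fun z : T * R => (X z.1, z.2)) measurable_heat2 m).
Qed.

Let measurable_heatX x : measurable_fun setT (fun w => heat (X w) x).
Proof. exact: (@measurable_fun_pair1 _ _ _ _ _ _ _ x measurable_heatX2). Qed.

Let integrable_bound (a b : R) : P.-integrable setT (fun w => (a * (1 + b * (X w)^-1))%:E).
Proof.
apply: integrableZR; apply: integrableDR; first exact: integrable_cstP.
exact: integrableZR.
Qed.

Lemma integrable_heatX x : P.-integrable setT (fun w => (heat (X w) x)%:E).
Proof.
apply: (@le_integrableR _ _ _ P _ (fun w => 1 * (1 + 1 * (X w)^-1))) => //.
by move=> w; rewrite ger0_norm ?heat_ge0// !mul1r heat_le.
Qed.

Lemma heat_mix_ge0 x : 0 <= heat_mix x.
Proof. by apply: Rintegral_ge0 => w _; exact: heat_ge0. Qed.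

Lemma is_derive_heat_mix (x : R) :
  is_derive x 1 heat_mix (\int[P]_w dheat (X w) x).
Proof.
apply: (@is_derive_under_integral _ _ _ P (fun x w => heat (X w) x)
  (fun x w => dheat (X w) x) (fun w => (X w)^-1) x (x - 1) (x + 1)) => //.
- by apply/andP; split; lra.
- by move=> y _; exact: integrable_heatX.
- by move=> y w _; exact: is_derive_heat.
- by move=> y w _; exact: dheat_le.
Qed.

Let measurable_dheatX x : measurable_fun setT (fun w => dheat (X w) x).
Proof.
apply: measurable_funM => //; apply: measurableT_comp => //.
by apply: measurable_funM => //; apply: measurable_funV; exact: measurable_funM.
Qed.

Lemma continuous_heat_mix : continuous heat_mix.
Proof. exact: (@is_derive_continuous _ _ _ is_derive_heat_mix). Qed.

Lemma cvg_heat_mix : heat_mix x @[x --> +oo] --> 0 /\ heat_mix x @[x --> -oo] --> 0.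
Proof.
apply: (@cvg0_normM_le _ _ 1) => x.
rewrite (ger0_norm (heat_mix_ge0 x)).
have -> : `|x| * heat_mix x = \int[P]_w (`|x| * heat (X w) x).
  by rewrite RintegralZl//; exact: integrable_heatX.
apply: (@le_trans _ _ (\int[P]_w 1)).
  apply: le_Rintegral => //; first exact/integrableZR/integrable_heatX.
    exact: integrable_cstP.
  by move=> w _; exact: normM_heat_le.
by rewrite Rintegral_cst_probability.
Qed.

Lemma cvg_derive1_heat_mix :
  derive1 heat_mix x @[x --> +oo] --> 0 /\ derive1 heat_mix x @[x --> -oo] --> 0.
Proof.
apply: (@cvg0_normM_le _ _ (\int[P]_w (2 * (1 + 1 * (X w)^-1)))) => x.
rewrite derive1E; case: (is_derive_heat_mix x) => _ ->.
have i : P.-integrable setT (fun w => (dheat (X w) x)%:E).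
  apply: (@le_integrableR _ _ _ P _ (fun w => (X w)^-1)) => // w.
  exact: dheat_le.
have i' : P.-integrable setT (fun w => `|dheat (X w) x|%:E).
  exact: integrable_abse i.
apply: (@le_trans _ _ (`|x| * \int[P]_w `|dheat (X w) x|)).
  by rewrite ler_wpM2l// le_normr_Rintegral.
have -> : `|x| * \int[P]_w `|dheat (X w) x| = \int[P]_w (`|x| * `|dheat (X w) x|).
  by rewrite RintegralZl//; exact: i'.
apply: le_Rintegral => //.
- exact: integrableZR i'.
- exact: integrable_bound.
- by move=> w _; rewrite mul1r normM_dheat_le.
Qed.

Section against_bounded.
Variables (phi : R -> R) (M : R).
Hypothesis mphi : measurable_fun setT phi.
Hypothesis phiM : forall x, `|phi x| <= M.

Let M0 : 0 <= M. Proof. exact: le_trans (phiM 0). Qed.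

Let mf : measurable_fun setT (fun z : T * R => heat (X z.1) z.2 * phi z.2).
Proof.
by apply: measurable_funM; [exact: measurable_heatX2|exact: measurableT_comp].
Qed.

Let f1 w : mu.-integrable setT (fun y => (heat (X w) y * phi y)%:E).
Proof. exact: integrable_heatM mphi phiM. Qed.

Let f2 y : P.-integrable setT (fun w => (heat (X w) y * phi y)%:E).
Proof.
apply: (@eq_integrableR _ _ _ P (fun w => phi y * heat (X w) y)).
  by move=> w; rewrite mulrC.
exact/integrableZR/integrable_heatX.
Qed.

(** Each kernel has mass one, so the inner integral is at most [M]. Taking [phi] constant, cosine or
    sine yields the integrability and the Fourier transforms of the mixture. *)
Let foo : (\int[P]_w \int[mu]_y `|heat (X w) y * phi y|%:E < +oo)%E.
Proof.
apply: (@lty_integral_dom _ _ _ _ _ P mu _ (fun=> M) mf (integrable_cstP M)) => w.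
rewrite -[leRHS]mule1 -(integral_heat (X w) (X0 w)) -integralZl//; last first.
  exact: integrable_heat.
apply: ge0_le_integral => //.
- by apply/measurable_EFinP; apply: measurableT_comp => //; apply: measurable_funM => //;
    exact: measurable_heat.
- by apply/measurable_EFinP; apply: measurable_funM => //; exact: measurable_heat.
- move=> y _; rewrite -EFinM lee_fin normrM (ger0_norm (heat_ge0 _ _)) mulrC.
  by rewrite ler_wpM2r ?heat_ge0.
Qed.

Let E y : \int[P]_w (heat (X w) y * phi y) = heat_mix y * phi y.
Proof. by rewrite RintegralZr//; exact: integrable_heatX. Qed.

Lemma integrable_heat_mixM :
  mu.-integrable setT (fun y => (heat_mix y * phi y)%:E).
Proof.
have := integrable_Rintegral2 _ _ _ _ _ P mu (fun w y => heat (X w) y * phi y) mf f2 foo.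
by apply: eq_integrableR => y; rewrite E.
Qed.

Lemma Rintegral_heat_mixM : \int[mu]_y (heat_mix y * phi y) =
  \int[P]_w (\int[mu]_y (heat (X w) y * phi y)).
Proof.
rewrite (RFubini _ _ _ _ _ P mu (fun w y => heat (X w) y * phi y) mf f1 f2 foo).
by apply: eq_Rintegral => y _; rewrite E.
Qed.

End against_bounded.

Lemma integrable_heat_mix : mu.-integrable setT (fun y => (heat_mix y)%:E).
Proof.
have c (y : R) : `|(fun=> 1) y| <= 1 :> R by rewrite normr1.
have i := integrable_heat_mixM (fun=> 1) 1 (measurable_cst _) c.
by apply: (@eq_integrableR _ _ _ mu _ heat_mix _ i) => y; rewrite mulr1.
Qed.

Definition laplace (s : R) : R := \int[P]_w expR (- (X w * s)).

Lemma fourier_cos_heat_mix xi : fourier_cos heat_mix xi = laplace (xi ^+ 2).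
Proof.
rewrite /fourier_cos (@Rintegral_heat_mixM (fun y => cos (xi * y)) 1).
- apply: eq_Rintegral => w _; rewrite -[RHS]mul1r -(fourier_heat (X w) xi 1 0 (X0 w)).
  by apply: eq_Rintegral => y _; rewrite /plane_wave mul0r addr0 mul1r.
- apply: eq_measurable_fun (measurable_plane_wave xi 1 0) => y _.
  by rewrite /plane_wave mul0r addr0 mul1r.
- by move=> y; exact: cos_max.
Qed.

Lemma fourier_sin_heat_mix xi : fourier_sin heat_mix xi = 0.
Proof.
rewrite /fourier_sin (@Rintegral_heat_mixM (fun y => sin (xi * y)) 1).
- transitivity (\int[P]_w (0 : R)); last by rewrite Rintegral_cst// mul0r.
  apply: eq_Rintegral => w _.
  have := fourier_heat (X w) xi 0 1 (X0 w); rewrite mul0r => <-.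
  by apply: eq_Rintegral => y _; rewrite /plane_wave mul0r add0r mul1r.
- apply: eq_measurable_fun (measurable_plane_wave xi 0 1) => y _.
  by rewrite /plane_wave mul0r add0r mul1r.
- by move=> y; exact: sin_max.
Qed.

(** Inversion holds for each kernel and passes to the mixture by Fubini. The double integral of
    absolute values is at most [E sqrt (pi / X)], which the inverse moment controls. *)
Lemma heat_mix_inversion x : heat_mix x =
  (2 * pi)^-1 * \int[mu]_xi (laplace (xi ^+ 2) * cos (xi * x)).
Proof.
have mcos : measurable_fun setT (fun xi : R => cos (xi * x)).
  apply: eq_measurable_fun (measurable_plane_wave x 1 0) => y _.
  by rewrite /plane_wave mul0r addr0 mul1r mulrC.
have mexp : measurable_fun setT (fun z : T * R => expR (- (X z.1 * z.2 ^+ 2))).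
  apply: measurableT_comp => //; apply: measurableT_comp => //.
  by apply: measurable_funM; [exact: measurableT_comp|exact: measurable_funX].
have mf : measurable_fun setT
    (fun z : T * R => expR (- (X z.1 * z.2 ^+ 2)) * cos (z.2 * x)).
  by apply: measurable_funM => //; exact: (measurableT_comp mcos).
have e0 w y : expR (- (X w * y ^+ 2)) <= 1.
  by rewrite -expR0 ler_expR oppr_le0 mulr_ge0 ?sqr_ge0 ?ltW.
have iexp w : mu.-integrable setT (fun y => (expR (- (X w * y ^+ 2)))%:E).
  apply: (@eq_integrableR _ _ _ mu
    (fun y => Num.sqrt (pi / X w) * heat (4 * X w)^-1 y)).
    by move=> y; rewrite expR_heat.
  by apply: integrableZR; apply: integrable_heat; rewrite invr_gt0 mulr_gt0.
have f1 w : mu.-integrable setT (fun y => (expR (- (X w * y ^+ 2)) * cos (y * x))%:E).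
  apply: (@le_integrableR _ _ _ mu _ (fun y => expR (- (X w * y ^+ 2)))).
  - exact: (@measurable_fun_pair2 _ _ _ _ _ _ _ w mf).
  - exact: iexp.
  - move=> y; rewrite normrM (ger0_norm (expR_ge0 _)) ler_piMr ?expR_ge0//.
    exact: cos_max.
have me y : measurable_fun setT (fun w => expR (- (X w * y ^+ 2))).
  exact: (@measurable_fun_pair1 _ _ _ _ _ _ _ y mexp).
have ie y : P.-integrable setT (fun w => (expR (- (X w * y ^+ 2)))%:E).
  apply: (@le_integrableR _ _ _ P _ (fun=> 1)) => //; first exact: integrable_cstP.
  by move=> w; rewrite ger0_norm ?expR_ge0.
have f2 y : P.-integrable setT (fun w => (expR (- (X w * y ^+ 2)) * cos (y * x))%:E).
  apply: (@eq_integrableR _ _ _ P (fun w => cos (y * x) * expR (- (X w * y ^+ 2)))).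
    by move=> w; rewrite mulrC.
  exact: integrableZR.
have foo : (\int[P]_w \int[mu]_y `|expR (- (X w * y ^+ 2)) * cos (y * x)|%:E < +oo)%E.
  apply: (@lty_integral_dom _ _ _ _ _ P mu _ (fun w => 1 * (1 + pi * (X w)^-1)) mf
    (integrable_bound 1 pi)) => w.
  have pX : 0 <= pi / X w by rewrite divr_ge0 ?pi_ge0// ltW.
  apply: (@le_trans _ _ (Num.sqrt (pi / X w))%:E).
    rewrite -[leRHS]mule1 -(@integral_heat _ (4 * X w)^-1) ?invr_gt0 ?mulr_gt0//.
    rewrite -integralZl//; last by apply: integrable_heat; rewrite invr_gt0 mulr_gt0.
    apply: ge0_le_integral => //.
    - apply/measurable_EFinP; apply: measurableT_comp => //.
      exact: (@measurable_fun_pair2 _ _ _ _ _ _ _ w mf).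
    - by apply/measurable_EFinP; apply: measurable_funM => //; exact: measurable_heat.
    - move=> y _; rewrite -EFinM lee_fin normrM (ger0_norm (expR_ge0 _)) -expR_heat//.
      by rewrite ler_piMr ?expR_ge0//; exact: cos_max.
  (* [q <= 1 + q^2] for [q = sqrt (pi / X)], from [(q - 1)^2 >= 0]. *)
  rewrite lee_fin mul1r -{2}(sqr_sqrtr pX).
  have := sqr_ge0 (Num.sqrt (pi / X w) - 1); rewrite sqrrB1 mulr2n.
  have := sqrtr_ge0 (pi / X w); lra.
have F := RFubini _ _ _ _ _ P mu
  (fun w y => expR (- (X w * y ^+ 2)) * cos (y * x)) mf f1 f2 foo.
transitivity ((2 * pi)^-1 *
    \int[P]_w (\int[mu]_y (expR (- (X w * y ^+ 2)) * cos (y * x)))).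
  rewrite -RintegralZl//.
    by apply: eq_Rintegral => w _; rewrite inverse_fourier_heat.
  apply: (@eq_integrableR _ _ _ P (fun w => 2 * pi * heat (X w) x)).
    by move=> w; rewrite -inverse_fourier_heat// mulVKf// gt_eqF// mulr_gt0// pi_gt0.
  exact/integrableZR/integrable_heatX.
rewrite F; congr (_ * _); apply: eq_Rintegral => y _.
by rewrite RintegralZr//; exact: ie.
Qed.

End heat_mixture.

(** * Law of subordinated Brownian motion *)

Lemma ae_measure_le {d} {T : measurableType d} {R : realType}
    (mu : {measure set T -> \bar R}) (A A' : set T) :
  measurable A -> measurable A' -> {ae mu, forall w, A w -> A' w} ->
  (mu A <= mu A')%E.
Proof.
move=> mA mA' AA'; rewrite -[A]setIT -[A']setIT -!integral_indic//.
apply: (@ae_ge0_le_integral _ _ _ mu) => //.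
- by apply/measurable_EFinP; exact: measurable_indic.
- by apply/measurable_EFinP; exact: measurable_indic.
- apply: filterS AA' => w Aw _; rewrite lee_fin !indicE.
  case: (boolP (w \in A)) => [|_]; last by rewrite ler0n.
  by rewrite inE => /Aw wA'; rewrite mem_set.
Qed.

Lemma ae_measure_eq {d} {T : measurableType d} {R : realType}
    (mu : {measure set T -> \bar R}) (A A' : set T) :
  measurable A -> measurable A' -> {ae mu, forall w, A w <-> A' w} -> mu A = mu A'.
Proof.
move=> mA mA' AA'; apply/eqP; rewrite eq_le !ae_measure_le//;
  by apply: filterS AA' => w [].
Qed.

Section density.
Context {R : realType}.
Local Notation mu := (@lebesgue_measure R).

(* On the left ray [U] the inequality is the hypothesis; on its complement, a
   closed ray, it follows from the open rays that decrease to it. *)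
Lemma density_of_open_le (Q : probability R R) (f : R -> R) :
  measurable_fun setT f -> (forall x, 0 <= f x) -> (\int[mu]_x (f x)%:E = 1)%E ->
  (forall U, open U -> (Q U <= \int[mu]_(x in U) (f x)%:E)%E) ->
  forall A, measurable A -> (Q A = \int[mu]_(x in A) (f x)%:E)%E.
Proof.
move=> mf f0 f1 QU.
pose nu0 (A : set R) := (\int[mu]_(x in A) (f x)%:E)%E.
have nu00 : nu0 set0 = 0%E by rewrite /nu0 integral_set0.
have nu0_ge0 A : (0 <= nu0 A)%E.
  by apply: integral_ge0 => x _; rewrite lee_fin.
have nu0_sigma : semi_sigma_additive nu0.
  move=> /= F mF tF mUF; rewrite /nu0 ge0_integral_bigcup//=.
  - apply: is_cvg_ereal_nneg_natsum_cond => n _ _.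
    by apply: integral_ge0 => x _; rewrite lee_fin.
  - by apply/measurable_EFinP; exact: measurable_funTS.
  - by move=> x _; rewrite lee_fin.
pose nu : {measure set R -> \bar R} :=
  HB.pack nu0 (isMeasure.Build _ _ R nu0 nu00 nu0_ge0 nu0_sigma).
have nuT : nu setT = 1%E by [].
have QT : Q setT = 1%E by exact: probability_setT.
have nu_fin A : measurable A -> (nu A < +oo)%E.
  move=> mA; apply: (@le_lt_trans _ _ (nu setT)); last by rewrite nuT ltry.
  by apply: le_measure; rewrite ?inE.
have Qge a : (Q `[a, +oo[%classic <= nu `[a, +oo[%classic)%E.
  pose D n : set R := `]a - n.+1%:R^-1, +oo[%classic.
  have mD n : measurable (D n) by exact: measurable_itv.
  have DE : `[a, +oo[%classic = \bigcap_n D n by rewrite itvcyEbigcap.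
  have ndD : nonincreasing_seq D.
    move=> m n mn; apply/subsetPset => x; rewrite /D/= !in_itv/= !andbT.
    apply: le_lt_trans; rewrite lerD2l lerN2 lef_pV2 ?posrE ?ltr0n//.
    by rewrite ler_nat.
  have mI : measurable (\bigcap_n D n) by rewrite -DE; exact: measurable_itv.
  have cQ : Q (D n) @[n --> \oo] --> Q (\bigcap_n D n).
    apply: nonincreasing_cvg_mu => //.
    by rewrite (le_lt_trans (probability_le1 _ _))// ltry.
  have cnu : nu (D n) @[n --> \oo] --> nu (\bigcap_n D n).
    by apply: nonincreasing_cvg_mu => //; exact: nu_fin.
  rewrite DE -(cvg_lim _ cQ)// -(cvg_lim _ cnu)//; apply: lee_lim.
  - by apply/cvg_ex; eexists; exact: cQ.
  - by apply/cvg_ex; eexists; exact: cnu.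
  - by apply: nearW => n; apply: QU; exact: interval_open.
move=> A mA.
(* Left rays form a pi-system that generates the Borel sets, and the rays [g n], of finite mass,
   exhaust the line. *)
pose g (n : nat) : set R := `]-oo, n%:R[%classic.
pose G : set (set R) := [set A | exists x, A = `]-oo, x[%classic].
refine (@measure_unique _ R R G g _ _ _ _ Q nu _ _ A mA).
- exact: RGenInftyO.measurableE.
- move=> _ _ [x ->] [y ->]; exists (Order.min x y); rewrite predeqE => z /=.
  by rewrite !in_itv/= lt_min; split => [[-> ->]//|/andP[]].
- by move=> n; exists n%:R.
- rewrite -subTset => x _; exists (Num.truncn x).+1 => //=.
  by rewrite /g/= in_itv/= truncnS_gt.
- move=> _ [a ->]; apply/eqP; rewrite eq_le; apply/andP; split.
    by apply: QU; exact: interval_open.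
  have mI : measurable (`]-oo, a[%classic : set R) by exact: measurable_itv.
  (* Both measures have mass one, so the upper bound on the closed ray becomes a lower bound on the
     left ray. *)
  have QC : Q `]-oo, a[%classic = (1 - Q `[a, +oo[%classic)%E.
    by rewrite -setCitvr probability_setC//; exact: measurable_itv.
  have nuC : (nu `]-oo, a[%classic + nu `[a, +oo[%classic = 1)%E.
    rewrite -nuT -measureU//; first by rewrite -setCitvr setvU.
    by rewrite -setCitvr setICl.
  have fn : nu `[a, +oo[%classic \is a fin_num.
    by rewrite ge0_fin_numE// nu_fin//; exact: measurable_itv.
  have fq : Q `[a, +oo[%classic \is a fin_num.
    by rewrite fin_num_measure//; exact: measurable_itv.
  suff : (nu `]-oo, a[%classic <= Q `]-oo, a[%classic)%E by [].
  by rewrite QC leeBrDr// -nuC leeD2l.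
- move=> k; rewrite (le_lt_trans (probability_le1 _ _))// ?ltry//.
  exact: measurable_itv.
Qed.


End density.

(** * Continuity of the Gaussian law in its time parameter *)

Section heat_time.
Context {R : realType}.
Local Notation mu := (@lebesgue_measure R).

Definition heat_measure (s : R) (U : set R) : \bar R :=
  (\int[mu]_(y in U) (heat s y)%:E)%E.

Lemma heat_measure_ge0 s U : (0 <= heat_measure s U)%E.
Proof. by apply: integral_ge0 => y _; rewrite lee_fin heat_ge0. Qed.

Lemma heat_measure_le1 s U : 0 < s -> measurable U -> (heat_measure s U <= 1)%E.
Proof.
move=> s0 mU; rewrite -(integral_heat s s0); apply: ge0_subset_integral => //.
- by apply/measurable_EFinP; exact: measurable_heat.
- by move=> y _; rewrite lee_fin heat_ge0.
Qed.

Lemma cvg_heat (s : R^nat) (s0 y : R) : 0 < s0 -> s @ \oo --> s0 ->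
  heat (s n) y @[n --> \oo] --> heat s0 y.
Proof.
move=> s00 ss; apply: cvgM.
  apply: (cvg_comp _ expR); last exact: continuous_expR.
  apply: cvgN; apply: cvgM; first exact: cvg_cst.
  apply: cvgV; first by rewrite gt_eqF// mulr_gt0.
  by apply: cvgM => //; exact: cvg_cst.
apply: cvgV; first by rewrite gt_eqF// sqrtr_gt0 !mulr_gt0// pi_gt0.
apply: (cvg_comp _ Num.sqrt); last exact: sqrt_continuous.
by apply: cvgM => //; exact: cvg_cst.
Qed.

(** For times in [[s0, s0 + 1]] the exponential is largest at [s0 + 1] and the prefactor at [s0];
    the majorant [G] combines these two, and is a multiple of the kernel at time [s0 + 1]. *)
Lemma cvg_heat_measure (s : R^nat) (s0 : R) (U : set R) : 0 < s0 ->
  (forall n, s0 <= s n <= s0 + 1) -> s @ \oo --> s0 -> measurable U ->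
  heat_measure (s n) U @[n --> \oo] --> heat_measure s0 U.
Proof.
move=> s00 sb ss mU.
have s10 : 0 < s0 + 1 by rewrite addr_gt0.
pose G y := Num.sqrt (4 * pi * (s0 + 1)) / Num.sqrt (4 * pi * s0) * heat (s0 + 1) y.
have q s1 : 0 < s1 -> 0 < Num.sqrt (4 * pi * s1) :> R.
  by move=> s10'; rewrite sqrtr_gt0 !mulr_gt0// pi_gt0.
have [|||||_ _ L] := @dominated_convergence _ _ R mu U mU
  (fun n y => (heat (s n) y)%:E) (fun y => (heat s0 y)%:E) (fun y => (G y)%:E);
  last exact: L.
- by move=> n; apply/measurable_EFinP/measurable_funTS; exact: measurable_heat.
- by apply/measurable_EFinP/measurable_funTS; exact: measurable_heat.
- by apply: aeW => y _; apply: cvg_EFin; [exact: nearW|exact: cvg_heat].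
- apply: integrableS (integrableZR _ (integrable_heat _ s10)) => //.
- apply: aeW => y n _; rewrite lee_fin ger0_norm ?heat_ge0// /G /heat.
  have /andP[sn0 sn1] := sb n; have sn : 0 < s n by rewrite (lt_le_trans s00).
  rewrite [leRHS](_ : _ = expR (- (y ^+ 2 / (4 * (s0 + 1)))) / Num.sqrt (4 * pi * s0));
    last by set e := expR _; field; rewrite !gt_eqF ?q.
  have e1 : expR (- (y ^+ 2 / (4 * s n))) <= expR (- (y ^+ 2 / (4 * (s0 + 1)))).
    rewrite ler_expR lerN2 ler_wpM2l ?sqr_ge0// lef_pV2 ?posrE ?mulr_gt0//.
    by rewrite ler_pM2l.
  have e2 : (Num.sqrt (4 * pi * s n))^-1 <= (Num.sqrt (4 * pi * s0))^-1.
    rewrite lef_pV2 ?posrE ?q// ler_sqrt.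
      by rewrite ler_pM2l// mulr_gt0// pi_gt0.
    by rewrite ltW// !mulr_gt0// pi_gt0.
  by rewrite ler_pM// ?expR_ge0 ?invr_ge0.
Qed.

End heat_time.

(** * Brownian motion at an independent random time *)

Section subordination.
Context {R : realType} {d} {T : measurableType d} (P : probability T R).
Local Notation mu := (@lebesgue_measure R).
Variables (B : R -> {RV P >-> R}) (Y : T -> R) (Z : {RV P >-> R}).
Hypothesis mY : measurable_fun setT Y.
Hypothesis Y0 : forall w, 0 < Y w.
Hypothesis iY : P.-integrable setT (fun w => (Y w)^-1%:E).
Hypothesis B_heat : forall s U, 0 < s -> measurable U ->
  P (B s @^-1` U) = heat_measure s U.
Hypothesis BY_indep : forall s U C, 0 <= s -> measurable U -> measurable C ->
  P (B s @^-1` U `&` Y @^-1` C) = (P (B s @^-1` U) * P (Y @^-1` C))%E.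
Hypothesis B_cont : {ae P, forall w,
  {within [set t : R | 0 <= t], continuous (fun t => B t w)}}.
Hypothesis ZE : {ae P, forall w, Z w = B (Y w) w}.

(* [Yn n] rounds [Y] up to the grid [{(k + 1) / (n + 1)}]. *)
Let sigma (n k : nat) : R := k.+1%:R / n.+1%:R.
Let rank n w := Num.truncn (n.+1%:R * Y w).
Let Yn n w := sigma n (rank n w).

Let sigma_gt0 n k : 0 < sigma n k.
Proof. by rewrite divr_gt0// ltr0n. Qed.

(** Rounding up keeps [Yn] between [Y] and [Y + 1], the window required by [cvg_heat_measure], and
    in particular positive. *)
Let Yn_bounds n w : Y w <= Yn n w <= Y w + n.+1%:R^-1.
Proof.
have n0 : (0 : R) < n.+1%:R by rewrite ltr0n.
have nY : 0 <= n.+1%:R * Y w by rewrite mulr_ge0// ltW.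
have /andP[h1 h2] := Num.Theory.truncn_itv nY.
rewrite /Yn /sigma /rank; apply/andP; split.
  by rewrite ler_pdivlMr// mulrC ltW.
by rewrite ler_pdivrMr// mulrDl mulVf ?gt_eqF// -natr1 lerD2r (mulrC (Y w)).
Qed.

Let Yn_cvg w : Yn n w @[n --> \oo] --> Y w.
Proof.
apply: (@squeeze_cvgr _ _ _ _ (fun=> Y w) (fun n => Y w + n.+1%:R^-1)).
- by apply: nearW => n; exact: Yn_bounds.
- exact: cvg_cst.
- rewrite -[X in _ --> X]addr0; apply: cvgD; first exact: cvg_cst.
  exact: cvg_harmonic.
Qed.

Let slab n k : set R := [set y | Num.truncn (n.+1%:R * y) = k].

Let measurable_slab n k : measurable (slab n k).
Proof.
(* [Num.truncn] is [0] on negative reals, so these sublevel sets are full left rays. *)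
have m j : measurable [set y : R | (Num.truncn (n.+1%:R * y) <= j)%N].
  rewrite (_ : [set _ | _] = `]-oo, j.+1%:R / n.+1%:R[%classic).
    exact: measurable_itv.
  apply/seteqP; split => y /=; rewrite in_itv/= Num.Theory.truncn_le_nat;
    by rewrite ltr_pdivlMr ?ltr0n// mulrC.
case: k => [|k].
  rewrite (_ : slab n 0 = [set y : R | (Num.truncn (n.+1%:R * y) <= 0)%N])//.
  by apply/seteqP; split => y; rewrite /slab/= leqn0; [move=> ->|move/eqP].
rewrite (_ : slab n k.+1 = [set y : R | (Num.truncn (n.+1%:R * y) <= k.+1)%N] `\`
  [set y : R | (Num.truncn (n.+1%:R * y) <= k)%N]); first exact: measurableD.
apply/seteqP; split => y; rewrite /slab/=.
  by move=> ->; rewrite leqnn ltnn.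
by move=> [h1 /negP]; rewrite -ltnNge => h2; apply/eqP; rewrite eqn_leq h1.
Qed.

Let cell n k := Y @^-1` slab n k.

Let measurable_cell n k : measurable (cell n k).
Proof.
rewrite -[cell n k]setTI; exact: (mY measurableT (slab n k) (measurable_slab n k)).
Qed.

Let bigcup_cell n : \bigcup_k cell n k = setT.
Proof. by rewrite -subTset => w _; exists (rank n w). Qed.

Let cell_inj n i j w : cell n i w -> cell n j w -> i = j.
Proof.
move=> wi wj; have <- : rank n w = i by exact: wi.
exact: wj.
Qed.

Let trivIset_cell n : trivIset setT (cell n).
Proof.
by apply/trivIsetP => i j _ _ ij; rewrite -subset0 => w [/cell_inj h /h /eqP]; rewrite (negbTE ij).
Qed.

(** The random index [rank n] is constant on each of countably many measurable cells. This makes [B]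
    measurable at the rounded time without joint measurability of [B]. *)
Let measurable_step d' (T' : measurableType d') n (g : nat -> T -> T') :
  (forall k, measurable_fun setT (g k)) ->
  measurable_fun setT (fun w => g (rank n w) w).
Proof.
move=> mg; rewrite -(bigcup_cell n); apply/measurable_fun_bigcup => // k.
apply: (eq_measurable_fun (g k)); last exact: measurable_funTS.
by move=> w; rewrite inE => <-.
Qed.

Let Bn n w := B (Yn n w) w.

Let measurable_Bn n : measurable_fun setT (Bn n).
Proof. exact: (@measurable_step _ _ n (fun k w => B (sigma n k) w)). Qed.

Let measurable_heat_measureYn n U :
  measurable_fun setT (fun w => heat_measure (Yn n w) U).
Proof. exact: (@measurable_step _ _ n (fun k w => heat_measure (sigma n k) U)). Qed.

Let law_Bn n U : measurable U ->
  P (Bn n @^-1` U) = (\int[P]_w heat_measure (Yn n w) U)%E.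
Proof.
move=> mU.
have mF k : measurable (B (sigma n k) @^-1` U `&` cell n k).
  by apply: measurableI => //; rewrite -[X in measurable X]setTI; exact: measurable_funP.
have -> : Bn n @^-1` U = \bigcup_k (B (sigma n k) @^-1` U `&` cell n k).
  apply/seteqP; split => w /=; first by move=> Uw; exists (rank n w).
  by move=> [k _ [/= h]]; rewrite /Bn /Yn /rank => ->.
rewrite measure_bigcup//; last first.
  apply/trivIsetP => i j _ _ ij; rewrite -subset0 => w [[_ wi] [_ wj]].
  by move: ij; rewrite (cell_inj n i j w wi wj) eqxx.
rewrite -(bigcup_cell n) ge0_integral_bigcup//.
- rewrite (@eq_eseriesl _ _ xpredT); last first.
    by move=> k; apply/idP; rewrite in_setT.
  apply: eq_eseriesr => k _.
  transitivity (P (B (sigma n k) @^-1` U) * P (Y @^-1` slab n k))%E.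
    by apply: BY_indep => //; exact: ltW.
  rewrite B_heat//.
  transitivity (\int[P]_(w in cell n k) cst (heat_measure (sigma n k) U) w)%E.
    by rewrite integral_cst//; exact: measurable_cell.
  by apply: eq_integral => w; rewrite inE /Yn /rank => ->.
- by rewrite bigcup_cell.
- by move=> w _; exact: heat_measure_ge0.
Qed.

Let measurable_heat_measureY U : measurable U ->
  measurable_fun setT (fun w => heat_measure (Y w) U).
Proof.
move=> mU; apply: (emeasurable_fun_cvg (fun n w => heat_measure (Yn n w) U)) => //.
move=> w _; apply: cvg_heat_measure => // n.
have /andP[-> h]/= := Yn_bounds n w; rewrite (le_trans h)// lerD2l.
by rewrite invf_le1 ?ltr0n// ler1n.
Qed.

Let heat_measure_cvg U : measurable U ->
  (\int[P]_w heat_measure (Yn n w) U)%E @[n --> \oo] -->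
  (\int[P]_w heat_measure (Y w) U)%E.
Proof.
move=> mU; have [|||||_ _ L] := @dominated_convergence _ _ R P setT measurableT
  (fun n w => heat_measure (Yn n w) U) (fun w => heat_measure (Y w) U) (cst 1%E);
  last exact: L.
- by move=> n; exact: measurable_heat_measureYn.
- exact: measurable_heat_measureY.
- apply: aeW => w _; apply: cvg_heat_measure => // n.
  have /andP[-> h]/= := Yn_bounds n w; rewrite (le_trans h)// lerD2l.
  by rewrite invf_le1 ?ltr0n// ler1n.
- exact: integrable_cstP.
- apply: aeW => w n _; rewrite gee0_abs ?heat_measure_ge0//.
  by apply: heat_measure_le1 => //; exact: sigma_gt0.
Qed.

(** One half of the portmanteau theorem, obtained pathwise: if the limit [B (Y)] lies in the open
    set [U], then [Bn] stays in [U] from some rank on. [A m] is the event that this happens from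
    rank [m], and its probability is bounded by that of [Bn] in [U] for all [n >= m], hence by the
    limit. *)
Let open_le (U : set R) : open U ->
  (P (Z @^-1` U) <= \int[P]_w heat_measure (Y w) U)%E.
Proof.
move=> oU; have mU : measurable U by exact: open_measurable.
have mZU : measurable (Z @^-1` U).
  by rewrite -[X in measurable X]setTI; exact: measurable_funP.
have mBU n : measurable (Bn n @^-1` U).
  by rewrite -[X in measurable X]setTI; exact: measurable_Bn.
have cvP : P (Bn n @^-1` U) @[n --> \oo] --> (\int[P]_w heat_measure (Y w) U)%E.
  by under eq_fun do rewrite law_Bn//; exact: heat_measure_cvg.
pose A m := \bigcap_(n in [set n | (m <= n)%N]) (Bn n @^-1` U).
have mA m : measurable (A m) by apply: bigcap_measurable => //; exists m => /=.
have ndA : nondecreasing_seq A.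
  by move=> m n mn; apply/subsetPset => w Aw k /= nk; apply: Aw; exact: leq_trans nk.
have mUA : measurable (\bigcup_m A m) by exact: bigcup_measurable.
have PA : P (A m) @[m --> \oo] --> P (\bigcup_m A m).
  exact: nondecreasing_cvg_mu.
apply: (@le_trans _ _ (P (\bigcup_m A m))).
  apply: ae_measure_le => //; apply: filterS2 B_cont ZE => w cw Zw /= UZw.
  have : B (Yn n w) w @[n --> \oo] --> B (Y w) w.
    apply: (cvg_comp (fun n => Yn n w) (fun t => B t w)); last first.
      by move/subspace_continuousP : cw; apply; rewrite /= ltW.
    (* Continuity of the path is relative to [0 <= t], so the rounded times must be shown to stay in
       that set. *)
    move=> S /= hS; have [N _ hN] := Yn_cvg w _ hS; exists N => // n /= Nn.
    apply: (hN n Nn); have /andP[h _] := Yn_bounds n w.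
    by rewrite /= (le_trans _ h)// ltW.
  rewrite -Zw => /(_ U) []; first exact: open_nbhs_nbhs.
  by move=> m _ mU'; exists m.
rewrite -(cvg_lim _ PA)//; apply: lime_le; first by apply/cvg_ex; eexists; exact: PA.
apply: nearW => m; rewrite -(cvg_lim _ cvP)//; apply: lime_ge.
  by apply/cvg_ex; eexists; exact: cvP.
exists m => // n /= mn; apply: le_measure; rewrite ?inE//.
by move=> w; apply.
Qed.

Lemma law_subordinated (A : set R) : measurable A ->
  P (Z @^-1` A) = (\int[mu]_(x in A) (heat_mix P Y x)%:E)%E.
Proof.
(* Tonelli: averaging the Gaussian laws over [Y] gives the measure with density [heat_mix]. *)
have mixE (U : set R) : measurable U -> (\int[P]_w heat_measure (Y w) U =
    \int[mu]_(x in U) (heat_mix P Y x)%:E)%E.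
  move=> mU; pose f z := (heat (Y z.1) z.2 * \1_U z.2)%:E.
  have mf : measurable_fun setT f.
    apply/measurable_EFinP; apply: measurable_funM.
      exact: (measurable_heatX2 Y mY).
    by apply: measurableT_comp => //; exact: measurable_indic.
  have f0 z : (0 <= f z)%E by rewrite lee_fin mulr_ge0 ?heat_ge0.
  have restr (g : R -> R) : (\int[mu]_(x in U) (g x)%:E = \int[mu]_x (g x * \1_U x)%:E)%E.
    rewrite integral_mkcond; apply: eq_integral => x _.
    by rewrite /patch indicE; case: ifP; rewrite ?mulr1 ?mulr0.
  rewrite restr; transitivity (\int[P]_w \int[mu]_y f (w, y))%E.
    by apply: eq_integral => w _; rewrite /heat_measure restr.
  etransitivity; first exact: (@fubini_tonelli _ _ _ _ _ P mu f mf f0).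
  apply: eq_integral => y _.
  rewrite /f/= indicE; case: (y \in U); last first.
    by rewrite mulr0; under eq_integral do rewrite mulr0; rewrite integral0.
  rewrite mulr1; under eq_integral do rewrite mulr1.
  by rewrite /heat_mix /Rintegral fineK//; apply: integrable_fin_num => //;
    exact: integrable_heatX.
apply: (density_of_open_le (distribution P Z) (heat_mix P Y)).
- by apply: continuous_measurable_fun; exact: continuous_heat_mix.
- exact: heat_mix_ge0.
- rewrite -mixE//; transitivity (\int[P]_w (cst 1%E w))%E.
    by apply: eq_integral => w _; rewrite /heat_measure integral_heat.
  by rewrite integral_cst// mul1e; exact: probability_setT.
- by move=> U oU; rewrite -mixE ?open_le//; exact: open_measurable.
Qed.

End subordination.

(** * The symbol and the evolution equation *)

Section symbol_bounds.
Context {R : realType}.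
Implicit Types alpha lambda s k c : R.

(** [N] is chosen so that [alpha (N + 1) >= 2]; then [exp y >= y^(N+1) / (N+1)!] turns the stretched
    exponential into quadratic decay. The factor [m = min 1 lambda] comes from
    [s + lambda >= m (1 + s)]. *)
Lemma expR_powR_le alpha lambda k : 0 < alpha -> 0 < lambda -> 0 < k ->
  exists2 C, 0 <= C &
    forall s, 0 <= s -> expR (- (k * (s + lambda) `^ alpha)) <= C / (1 + s) ^+ 2.
Proof.
move=> a0 l0 k0; pose N := (Num.truncn (2 / alpha)).
have aN : 2 <= alpha * N.+1%:R.
  by rewrite mulrC -ler_pdivrMr// ltW// truncnS_gt.
pose m := Num.min 1 lambda.
have m0 : 0 < m by rewrite lt_min ltr01.
pose D := k ^+ N.+1 * (m `^ alpha) ^+ N.+1.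
have D0 : 0 < D by rewrite mulr_gt0 ?exprn_gt0// powR_gt0.
have f0 : (0 : R) < (N.+1)`!%:R by rewrite ltr0n fact_gt0.
exists ((N.+1)`!%:R / D); first by rewrite divr_ge0 ?ltW.
move=> s s0; have s1 : 0 < 1 + s by rewrite ltr_wpDr.
have y0 : 0 <= k * (s + lambda) `^ alpha by rewrite mulr_ge0 ?powR_ge0 ?ltW.
rewrite expRN [leRHS](_ : _ = (D * (1 + s) ^+ 2 / (N.+1)`!%:R)^-1); last first.
  by field; rewrite !gt_eqF.
rewrite lef_pV2 ?posrE ?expR_gt0//; last by rewrite divr_gt0// mulr_gt0// exprn_gt0.
apply: (@le_trans _ _ ((k * (s + lambda) `^ alpha) ^+ N.+1 / (N.+1)`!%:R)); last first.
  by rewrite (le_trans _ (expR_ge1Dxn N y0))// lerDr.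
rewrite ler_pM2r ?invr_gt0// exprMn /D -mulrA ler_pM2l ?exprn_gt0//.
apply: (@le_trans _ _ ((m `^ alpha * (1 + s) `^ alpha) ^+ N.+1)).
  rewrite exprMn ler_pM2l ?exprn_gt0 ?powR_gt0//.
  have -> : ((1 + s) `^ alpha) ^+ N.+1 = (1 + s) `^ (alpha * N.+1%:R).
    by rewrite powRrM powR_mulrn// powR_ge0.
  have -> : (1 + s) ^+ 2 = (1 + s) `^ 2%:R by rewrite powR_mulrn// ltW.
  by apply: ler_powR => //; rewrite lerDl.
rewrite lerXn2r ?nnegrE ?mulr_ge0 ?powR_ge0// -(powRM _ (ltW m0) (ltW s1)).
apply: ge0_ler_powR; rewrite ?nnegrE ?(ltW a0)//.
- by rewrite mulr_ge0 ?ltW.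
- by rewrite addr_ge0// ltW.
- rewrite mulrDr mulr1 addrC lerD//; last by rewrite /m ge_min lexx orbT.
  by rewrite ler_piMl// /m ge_min lexx.
Qed.

(** [u^alpha <= 1 + u] for [u >= 0]. Linear growth in [s = xi^2] is all that the quadratic decay has
    to compensate. *)
Lemma powR_le_affine alpha lambda s : 0 < alpha < 1 -> 0 < lambda -> 0 <= s ->
  (s + lambda) `^ alpha <= (1 + lambda) * (1 + s).
Proof.
move=> /andP[a0 a1] l0 s0; have ls : 0 <= lambda * s by rewrite mulr_ge0// ltW.
apply: (@le_trans _ _ (1 + (s + lambda))); last first.
  by rewrite mulrDl mul1r mulrDr mulr1; lra.
have [h|h] := leP (s + lambda) 1.
  apply: (@le_trans _ _ 1); last by rewrite lerDl addr_ge0// ltW.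
  have -> : 1 = 1 `^ alpha :> R by rewrite powR1.
  by apply: ge0_ler_powR; rewrite ?nnegrE ?(ltW a0)// addr_ge0// ltW.
by apply: le_trans (ler1_powR (ltW h) (ltW a1)) _; rewrite lerDr.
Qed.

(** The Laplace exponent of a tempered stable subordinator, weighted by [c]; it vanishes at
    [s = 0]. *)
Definition bernstein c alpha lambda s : R :=
  c * ((s + lambda) `^ alpha - lambda `^ alpha).

Lemma bernstein_ge0 c alpha lambda s : 0 <= c -> 0 < alpha -> 0 < lambda ->
  0 <= s -> 0 <= bernstein c alpha lambda s.
Proof.
move=> c0 a0 l0 s0; rewrite mulr_ge0// subr_ge0 ge0_ler_powR ?nnegrE ?(ltW a0) ?(ltW l0)//.
  by rewrite addr_ge0// ltW.
by rewrite lerDr.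
Qed.

Lemma bernstein_le c alpha lambda s : 0 <= c -> 0 < alpha < 1 -> 0 < lambda ->
  0 <= s -> bernstein c alpha lambda s <= c * (1 + lambda) * (1 + s).
Proof.
move=> c0 a01 l0 s0; rewrite -mulrA ler_wpM2l//.
rewrite (le_trans _ (powR_le_affine alpha lambda s a01 l0 s0))//.
by rewrite gerBl powR_ge0.
Qed.

(** The tempering shift [- lambda^alpha] contributes only the constant factor
    [exp (t c lambda^alpha)]. *)
Lemma expR_bernstein_le c alpha lambda t : 0 < c -> 0 < alpha -> 0 < lambda ->
  0 < t -> exists2 C, 0 <= C & forall s, 0 <= s ->
    expR (- (t * bernstein c alpha lambda s)) <= C / (1 + s) ^+ 2.
Proof.
move=> c0 a0 l0 t0; have [C C0 hC] := expR_powR_le alpha lambda (t * c) a0 l0 (mulr_gt0 t0 c0).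
exists (expR (t * c * lambda `^ alpha) * C); first by rewrite mulr_ge0// expR_ge0.
move=> s s0; rewrite -[leRHS]mulrA.
apply: le_trans (ler_wpM2l (expR_ge0 (t * c * lambda `^ alpha)) (hC s s0)).
rewrite -expRD (_ : _ + _ = - (t * bernstein c alpha lambda s))//.
by rewrite /bernstein; ring.
Qed.

Lemma measurable_bernstein c alpha lambda :
  measurable_fun setT (fun xi : R => bernstein c alpha lambda (xi ^+ 2)).
Proof.
apply: measurable_funM => //; apply: measurable_funB => //.
apply: (@measurableT_comp _ _ _ _ _ _ (fun x : R => x `^ alpha)).
  exact: measurable_powR.
by apply: measurable_funD => //; exact: measurable_funX.
Qed.

Lemma measurable_frac_symbol lambda alpha :
  measurable_fun setT (frac_symbol lambda alpha).
Proof.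
apply: (@measurableT_comp _ _ _ _ _ _ (fun x : R => x `^ alpha)).
  exact: measurable_powR.
by apply: measurable_funD => //; exact: measurable_funX.
Qed.

Lemma frac_symbol_ge0 lambda alpha xi : 0 <= frac_symbol lambda alpha xi.
Proof. exact: powR_ge0. Qed.

Lemma frac_symbol_le lambda alpha xi : 0 < alpha < 1 -> 0 < lambda ->
  frac_symbol lambda alpha xi <= (1 + lambda) * (1 + xi ^+ 2).
Proof. by move=> a l; rewrite /frac_symbol addrC powR_le_affine// sqr_ge0. Qed.

End symbol_bounds.

(** * Inverse moment from the Laplace transform *)

Section inverse_moment.
Context {R : realType} {d} {T : measurableType d} (P : probability T R).
Local Notation mu := (@lebesgue_measure R).
Variable X : T -> R.
Hypothesis mX : measurable_fun setT X.
Hypothesis X0 : forall w, 0 < X w.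

Let integral_expRN (y : R) : 0 < y ->
  (\int[mu]_u (\1_`[0, +oo[ u * expR (- (y * u)))%:E = (y^-1)%:E)%E.
Proof.
move=> y0; transitivity (y^-1%:E * \int[mu]_u (exponential_pdf y u)%:E)%E; last first.
  by rewrite integral_exponential_pdf// mule1.
rewrite -ge0_integralZl//.
- apply: eq_integral => u _; rewrite -EFinM; congr _%:E.
  rewrite /exponential_pdf /patch indicE; case: ifP => _; last by rewrite mul0r mulr0.
  by rewrite mul1r mulNr mulKf// gt_eqF.
- by apply/measurable_EFinP; exact: measurable_exponential_pdf.
- by move=> u _; rewrite lee_fin exponential_pdf_ge0// ltW.
- by rewrite lee_fin invr_ge0 ltW.
Qed.

(** Since [1 / X] is the integral of [exp (- u X)] over [u >= 0], Tonelli gives [E (1 / X)] as the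
    integral of the Laplace transform. The inequality [(1 + u)^2 >= 1 + u^2] reduces it to
    [integrable_oneDsqrV]. *)
Lemma integrable_inverse (C : R) :
  (forall s, 0 <= s -> laplace P X s <= C / (1 + s) ^+ 2) ->
  P.-integrable setT (fun w => (X w)^-1%:E).
Proof.
move=> LC.
have C0 : 0 <= C.
  have := LC 0 (lexx 0); rewrite addr0 expr1n divr1; apply: le_trans.
  by apply: Rintegral_ge0 => w _; exact: expR_ge0.
have mf : measurable_fun setT (fun z : T * R => \1_`[0, +oo[ z.2 * expR (- (X z.1 * z.2)) : R).
  apply: measurable_funM.
    by apply: measurableT_comp => //; apply: measurable_indic; exact: measurable_itv.
  apply: measurableT_comp => //; apply: measurableT_comp => //.
  by apply: measurable_funM => //; exact: measurableT_comp.
have mexp s : measurable_fun setT (fun w => expR (- (X w * s))).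
  apply: measurableT_comp => //; apply: measurableT_comp => //.
  exact: measurable_funM.
have iexp s : 0 <= s -> P.-integrable setT (fun w => (expR (- (X w * s)))%:E).
  move=> s0; apply: (@le_integrableR _ _ _ P _ (fun=> 1)) => //.
    exact: integrable_cstP.
  move=> w; rewrite ger0_norm ?expR_ge0// -expR0 ler_expR oppr_le0.
  by rewrite mulr_ge0// ltW.
apply/integrableP; split; first by apply/measurable_EFinP; exact: measurable_funV.
apply: (@le_lt_trans _ _ (\int[mu]_u (C * (1 + u ^+ 2)^-1)%:E)%E); last first.
  by apply: integrable_lty => //; apply: integrableZR; exact: integrable_oneDsqrV.
rewrite [leLHS](_ : _ = \int[P]_w \int[mu]_u
    (\1_`[0, +oo[ u * expR (- (X w * u)))%:E)%E; last first.
  apply: eq_integral => w _; rewrite integral_expRN//= ger0_norm// invr_ge0 ltW//.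
pose f z := (\1_`[0, +oo[ z.2 * expR (- (X z.1 * z.2)))%:E.
have mEf : measurable_fun setT f by exact/measurable_EFinP.
have f0 z : (0 <= f z)%E by rewrite lee_fin mulr_ge0 ?expR_ge0.
rewrite (_ : (\int[P]_w _)%E = (\int[mu]_u \int[P]_w f (w, u))%E); last first.
  exact: (@fubini_tonelli _ _ _ _ _ P mu f mEf f0).
apply: ge0_le_integral => //.
- by move=> u _; exact: integral_ge0.
- exact: (@measurable_fun_fubini_tonelli_G _ _ _ _ _ P f mEf f0).
- by apply: measurable_int; apply: integrableZR; exact: integrable_oneDsqrV.
- move=> u _; rewrite /f/= indicE; case: (boolP (u \in _)) => u0.
    have {}u0 : 0 <= u by move: u0; rewrite inE/= in_itv/= andbT.
    under eq_integral do rewrite mul1r.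
    have := LC u u0; rewrite -lee_fin /laplace /Rintegral fineK; last first.
      by apply: integrable_fin_num => //; exact: iexp.
    move/le_trans; apply; rewrite lee_fin ler_wpM2l// lef_pV2 ?posrE.
    + by rewrite sqrrD expr1n mul1r -addrA lerD2l lerDr mulrn_wge0.
    + by rewrite exprn_gt0// ltr_wpDr.
    + by rewrite ltr_wpDr// sqr_ge0.
  under eq_integral do rewrite mul0r.
  by rewrite integral0 lee_fin mulr_ge0// invr_ge0 addr_ge0// sqr_ge0.
Qed.

End inverse_moment.

(** * The equation as a Fourier multiplier identity *)

Section evolution.
Context {R : realType} {d} {T : measurableType d} (P : probability T R).
Local Notation mu := (@lebesgue_measure R).
Variables alpha1 alpha2 lambda1 lambda2 c1 c2 : R.
Hypotheses (halpha1 : 0 < alpha1 < 1) (halpha2 : 0 < alpha2 < 1).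
Hypotheses (hlambda1 : 0 < lambda1) (hlambda2 : 0 < lambda2).
Hypotheses (hc1 : 0 <= c1) (hc2 : 0 <= c2) (hc : c1 + c2 = 1).

Definition mixture_symbol (s : R) : R :=
  bernstein c1 alpha1 lambda1 s + bernstein c2 alpha2 lambda2 s.

Local Notation psi := mixture_symbol.

Lemma mixture_symbol_ge0 s : 0 <= s -> 0 <= psi s.
Proof.
move: halpha1 halpha2 => /andP[a1 _] /andP[a2 _] s0.
by rewrite addr_ge0// bernstein_ge0.
Qed.

Lemma mixture_symbol_le : exists2 K, 0 <= K & forall s, 0 <= s -> psi s <= K * (1 + s).
Proof.
exists (c1 * (1 + lambda1) + c2 * (1 + lambda2)).
  by rewrite addr_ge0// mulr_ge0// addr_ge0// ltW.
by move=> s s0; rewrite mulrDl lerD// bernstein_le.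
Qed.

(** Since [c1 + c2 = 1], one of the weights is positive; its exponential carries the decay and the
    other is at most [1]. *)
Lemma expR_mixture_symbol_le t : 0 < t ->
  exists2 C, 0 <= C & forall s, 0 <= s -> expR (- (t * psi s)) <= C / (1 + s) ^+ 2.
Proof.
move=> t0; have [/andP[a1 _] /andP[a2 _]] := (halpha1, halpha2).
have le1 x : 0 <= x -> expR (- (t * x)) <= 1.
  by move=> x0; rewrite -expR0 ler_expR oppr_le0 mulr_ge0// ltW.
have [c10|c10] := ltP 0 c1.
  have [C C0 hC] := expR_bernstein_le c1 alpha1 lambda1 t c10 a1 hlambda1 t0.
  exists C => // s s0; rewrite /mixture_symbol mulrDr opprD expRD.
  rewrite (le_trans _ (hC s s0))// ler_piMr ?expR_ge0//.
  by rewrite le1// bernstein_ge0.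
have c20 : 0 < c2.
  have -> : c2 = 1 - c1 by rewrite -hc addrC addKr.
  by rewrite subr_gt0 (le_lt_trans c10).
have [C C0 hC] := expR_bernstein_le c2 alpha2 lambda2 t c20 a2 hlambda2 t0.
exists C => // s s0; rewrite /mixture_symbol mulrDr opprD expRD.
rewrite (le_trans _ (hC s s0))// ler_piMl ?expR_ge0//.
by rewrite le1// bernstein_ge0.
Qed.

Let measurable_psi : measurable_fun setT (fun xi : R => psi (xi ^+ 2)).
Proof. by apply: measurable_funD; exact: measurable_bernstein. Qed.

(** The characteristic function of [Z t], real because the law is symmetric. *)
Let E t xi := expR (- (t * psi (xi ^+ 2))).

Let measurable_E t : measurable_fun setT (E t).
Proof.
apply: measurableT_comp => //; apply: measurableT_comp => //.
exact: measurable_funM.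
Qed.

Let E_ge0 t xi : 0 <= E t xi. Proof. exact: expR_ge0. Qed.

(** A multiplier of growth [1 + xi^2] against decay [(1 + xi^2)^-2] leaves the majorant
    [K C / (1 + xi^2)]. *)
Let integrable_multiplier t K (m : R -> R) : 0 < t -> measurable_fun setT m ->
  (forall xi, `|m xi| <= K * (1 + xi ^+ 2)) ->
  mu.-integrable setT (fun xi => (m xi * E t xi)%:E).
Proof.
move=> t0 mm mK; have [C C0 hC] := expR_mixture_symbol_le t t0.
have K0 : 0 <= K.
  by have := le_trans (normr_ge0 _) (mK 0); rewrite expr0n addr0 mulr1.
apply: (@le_integrableR _ _ _ mu _ (fun xi => K * C * (1 + xi ^+ 2)^-1)).
- by apply: measurable_funM => //; exact: measurable_E.
- by apply: integrableZR; exact: integrable_oneDsqrV.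
- move=> xi; have x0 : 0 < 1 + xi ^+ 2 by rewrite ltr_wpDr// sqr_ge0.
  rewrite normrM (ger0_norm (E_ge0 _ _)).
  rewrite (le_trans (ler_pM (normr_ge0 _) (E_ge0 _ _) (mK xi) (hC _ (sqr_ge0 xi))))//.
  by rewrite le_eqVlt; apply/orP; left; apply/eqP; field; rewrite gt_eqF.
Qed.

Let integrable_trig t K (m : R -> R) (g : R -> R) : 0 < t ->
  measurable_fun setT m -> measurable_fun setT g -> (forall xi, `|g xi| <= 1) ->
  (forall xi, `|m xi| <= K * (1 + xi ^+ 2)) ->
  mu.-integrable setT (fun xi => (m xi * (E t xi * g xi))%:E).
Proof.
move=> t0 mm mg g1 mK.
apply: (@eq_integrableR _ _ _ mu (fun xi => (m xi * g xi) * E t xi)).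
  by move=> xi; ring.
apply: (@integrable_multiplier t K) => //; first exact: measurable_funM.
by move=> xi; rewrite normrM (le_trans _ (mK xi))// ler_piMr.
Qed.

Let measurable_cosx (x : R) : measurable_fun setT (fun xi : R => cos (xi * x)).
Proof.
apply: eq_measurable_fun (measurable_plane_wave x 1 0) => y _.
by rewrite /plane_wave mul0r addr0 mul1r mulrC.
Qed.

Variable X : R -> T -> R.
Hypothesis mX : forall t, 0 < t -> measurable_fun setT (X t).
Hypothesis X0 : forall t w, 0 < t -> 0 < X t w.
Hypothesis iX : forall t, 0 < t -> P.-integrable setT (fun w => (X t w)^-1%:E).
Hypothesis laplaceX : forall t s, 0 < t -> 0 <= s ->
  laplace P (X t) s = expR (- (t * psi s)).

Let r x t := heat_mix P (X t) x.

Let fourier_cos_r t xi : 0 < t -> fourier_cos (r ^~ t) xi = E t xi.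
Proof.
move=> t0; rewrite /E -laplaceX ?sqr_ge0//.
by rewrite -(fourier_cos_heat_mix P (X t) (mX t t0) (fun w => X0 t w t0) (iX t t0)).
Qed.

Let fourier_sin_r t xi : 0 < t -> fourier_sin (r ^~ t) xi = 0.
Proof.
move=> t0.
by rewrite -(fourier_sin_heat_mix P (X t) (mX t t0) (fun w => X0 t w t0) (iX t t0) xi).
Qed.

Lemma frac_dom_mixture lambda alpha t : 0 < t -> 0 < alpha < 1 -> 0 < lambda ->
  frac_dom lambda alpha (r ^~ t).
Proof.
move=> t0 a01 l0; split.
- exact: (integrable_heat_mix P (X t) (mX t t0) (fun w => X0 t w t0) (iX t t0)).
- apply: (@eq_integrableR _ _ _ mu (fun xi => frac_symbol lambda alpha xi * E t xi)).
    by move=> xi; rewrite fourier_cos_r.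
  apply: (@integrable_multiplier t (1 + lambda)) => //.
    exact: measurable_frac_symbol.
  by move=> xi; rewrite ger0_norm ?frac_symbol_ge0// frac_symbol_le.
- apply: (@eq_integrableR _ _ _ mu (fun xi => 0 * E t xi)).
    by move=> xi; rewrite fourier_sin_r// mul0r mulr0.
  apply: (@integrable_multiplier t 0) => //.
  by move=> xi; rewrite normr0 mul0r.
Qed.

Let frac_op_r lambda alpha t x : 0 < t -> frac_op lambda alpha (r ^~ t) x =
  (2 * pi)^-1 * \int[mu]_xi (frac_symbol lambda alpha xi * (E t xi * cos (xi * x))).
Proof.
move=> t0; congr (_ * _); apply: eq_Rintegral => xi _.
by rewrite fourier_cos_r// fourier_sin_r// mul0r addr0.
Qed.

Let r_inversion x t : 0 < t ->
  r x t = (2 * pi)^-1 * \int[mu]_xi (E t xi * cos (xi * x)).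
Proof.
move=> t0.
rewrite /r (heat_mix_inversion P (X t) (mX t t0) (fun w => X0 t w t0) (iX t t0)).
by congr (_ * _); apply: eq_Rintegral => xi _; rewrite laplaceX// sqr_ge0.
Qed.

Lemma is_derive_mixture (x t : R) : 0 < t ->
  is_derive t 1 (fun u => r x u)
    (- c1 * frac_op lambda1 alpha1 (r ^~ t) x
     - c2 * frac_op lambda2 alpha2 (r ^~ t) x
     + c1 * lambda1 `^ alpha1 * r x t
     + c2 * lambda2 `^ alpha2 * r x t).
Proof.
move=> t0; have [K K0 hK] := mixture_symbol_le.
have psi0 xi : 0 <= psi (xi ^+ 2) by rewrite mixture_symbol_ge0// sqr_ge0.
have psiK xi : `|psi (xi ^+ 2)| <= K * (1 + xi ^+ 2).
  by rewrite ger0_norm// hK// sqr_ge0.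
have cos1 xi : `|cos (xi * x)| <= 1 by exact: cos_max.
have t20 : 0 < t / 2 by rewrite divr_gt0.
have ic s : 0 < s -> mu.-integrable setT (fun xi => (E s xi * cos (xi * x))%:E).
  move=> s0; apply: (@eq_integrableR _ _ _ mu (fun xi => 1 * (E s xi * cos (xi * x)))).
    by move=> xi; rewrite mul1r.
  apply: (@integrable_trig s 1) => // xi.
  by rewrite normr1 mul1r lerDl sqr_ge0.
have isym l a : 0 < a < 1 -> 0 < l -> mu.-integrable setT
    (fun xi => (frac_symbol l a xi * (E t xi * cos (xi * x)))%:E).
  move=> a01 l0; apply: (@integrable_trig t (1 + l)) => //.
    exact: measurable_frac_symbol.
  by move=> xi; rewrite ger0_norm ?frac_symbol_ge0// frac_symbol_le.
(* On []t / 2, t + 1[] the factor [E s] is at most [E (t / 2)], because [psi >= 0]; this provides a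
   majorant independent of [s]. *)
have D : is_derive t 1 (fun s => \int[mu]_xi (E s xi * cos (xi * x)))
    (\int[mu]_xi (- psi (xi ^+ 2) * (E t xi * cos (xi * x)))).
  apply: (@is_derive_under_integral _ _ _ mu (fun s xi => E s xi * cos (xi * x))
    (fun s xi => - psi (xi ^+ 2) * (E s xi * cos (xi * x)))
    (fun xi => psi (xi ^+ 2) * E (t / 2) xi) t (t / 2) (t + 1)).
  - by apply/andP; split; lra.
  - by move=> s /andP[s0 _]; apply: ic; rewrite (lt_trans t20).
  - move=> s xi _.
    have D1 : is_derive s 1 (fun u : R => - (u * psi (xi ^+ 2))) (- psi (xi ^+ 2)).
      have D1 := is_deriveN (is_deriveZ (psi (xi ^+ 2)) (is_derive_id s 1)).
      rewrite (_ : (fun u => _) = - (psi (xi ^+ 2) \*: id)); last first.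
        by apply/funext => u; rewrite /= mulrC.
      by apply: is_derive_eq D1 _; rewrite /GRing.scale/= mulr1.
    have D2 := is_deriveZ (cos (xi * x)) (is_derive1_comp (is_derive_expR _) D1).
    rewrite (_ : (fun u => _) = cos (xi * x) \*:
      (expR \o (fun u : R => - (u * psi (xi ^+ 2))))); last first.
      by apply/funext => u; rewrite /E mulrC.
    by apply: is_derive_eq D2 _; rewrite /E /GRing.scale/=; ring.
  - exact: (@integrable_multiplier (t / 2) K).
  - move=> s xi /andP[s0 _]; rewrite mulrA normrM.
    rewrite -[leRHS]mulr1 ler_pM//.
    rewrite normrM normrN !ger0_norm// ler_wpM2l// ler_expR lerN2.
    by rewrite ler_wpM2r// ltW.
have i1 := isym _ _ halpha1 hlambda1; have i2 := isym _ _ halpha2 hlambda2.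
have i0 := ic _ t0.
(* [- psi (xi^2)] is minus the weighted sum of the two symbols plus the constants
   [c_i lambda_i^alpha_i], so the time derivative splits into the terms of the equation. *)
have key : \int[mu]_xi (- psi (xi ^+ 2) * (E t xi * cos (xi * x))) =
    - c1 * \int[mu]_xi (frac_symbol lambda1 alpha1 xi * (E t xi * cos (xi * x)))
    + - c2 * \int[mu]_xi (frac_symbol lambda2 alpha2 xi * (E t xi * cos (xi * x)))
    + (c1 * lambda1 `^ alpha1 + c2 * lambda2 `^ alpha2) *
      \int[mu]_xi (E t xi * cos (xi * x)).
  rewrite -(RintegralZl (- c1) measurableT i1) -(RintegralZl (- c2) measurableT i2).
  rewrite -(RintegralZl (c1 * lambda1 `^ alpha1 + c2 * lambda2 `^ alpha2) measurableT i0).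
  rewrite -RintegralD//; [|exact: integrableZR|exact: integrableZR].
  rewrite -RintegralD//; last 2 first.
  - by apply: integrableDR; exact: integrableZR.
  - exact: integrableZR.
  apply: eq_Rintegral => xi _.
  rewrite /mixture_symbol /bernstein /frac_symbol (addrC lambda1) (addrC lambda2).
  by ring.
have alg (k J1 J2 J0 a b : R) :
    k * (- c1 * J1 + - c2 * J2 + (c1 * a + c2 * b) * J0) =
    - c1 * (k * J1) - c2 * (k * J2) + c1 * a * (k * J0) + c2 * b * (k * J0) by ring.
have D' := is_deriveZ (2 * pi)^-1 D.
(* The inversion formula holds at positive times only; a neighbourhood of [t] suffices for the
   derivative. *)
apply: (@near_eq_is_derive _ _ _
  ((2 * pi)^-1 \*: (fun s => \int[mu]_xi (E s xi * cos (xi * x))))).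
  by near=> s; rewrite r_inversion//; near: s; exact: lt_nbhsr.
apply: is_derive_eq D' _; rewrite !frac_op_r// r_inversion// /GRing.scale/=.
rewrite key; exact: alg.
Unshelve. all: by end_near. Qed.

End evolution.

(** * Initial condition *)

Section initial_condition.
Context {R : realType} {d} {T : measurableType d} (P : probability T R).
Local Notation mu := (@lebesgue_measure R).

(** On [X <= 0] the variable [exp (- s X)] is at least [1], so [P (X <= 0) <= C / (1 + s)^2] for
    every [s > 0]. *)
Lemma ae_gt0_of_laplace (X : T -> R) (C : R) : measurable_fun setT X -> 0 <= C ->
  (forall s, 0 < s ->
    (\int[P]_w (expR (- s * X w))%:E <= (C / (1 + s) ^+ 2)%:E)%E) ->
  {ae P, forall w, 0 < X w}.
Proof.
move=> mX C0 h; pose N := [set w | X w <= 0].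
have mN : measurable N.
  rewrite (_ : N = X @^-1` `]-oo, 0]%classic); last first.
    by apply/seteqP; split => w; rewrite /N/= in_itv/=.
  by rewrite -[X in measurable X]setTI; apply: mX.
have PN s : 0 < s -> (P N <= (C / (1 + s) ^+ 2)%:E)%E.
  move=> s0; apply: le_trans (h s s0); rewrite -[N]setIT -integral_indic//.
  apply: ge0_le_integral => //.
  - by apply/measurable_EFinP; exact: measurable_indic.
  - apply/measurable_EFinP; apply: measurableT_comp => //.
    exact: measurable_funM.
  - move=> w _; rewrite lee_fin indicE; case: (boolP (w \in N)) => [|_]; last exact: expR_ge0.
    rewrite inE /N/= => Xw; rewrite -expR0 ler_expR mulNr oppr_ge0.
    by rewrite mulr_ge0_le0// ltW.
have PN0 : P N = 0%E.
  apply/eqP; rewrite eq_le measure_ge0 andbT.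
  apply/lee_addgt0Pr => e e0; rewrite add0e.
  (* This value of [s] gives [C <= e (1 + s) <= e (1 + s)^2]. *)
  have s0 : 0 < C / e + 1 by rewrite ltr_wpDl// divr_ge0// ltW.
  rewrite (le_trans (PN _ s0))// lee_fin.
  have s1 : 1 <= 1 + (C / e + 1) by rewrite lerDl ltW.
  have s2 : 0 < 1 + (C / e + 1) by rewrite (lt_le_trans _ s1).
  rewrite ler_pdivrMr ?exprn_gt0//.
  apply: (@le_trans _ _ (e * (1 + (C / e + 1)))); last first.
    by rewrite ler_pM2l// expr2 ler_peMr// ltW.
  by rewrite !mulrDr mulr1 mulrCA divff ?gt_eqF// mulr1; lra.
exists N; split => // w /= /negP; rewrite -leNgt//.
Qed.

(** Almost sure convergence implies convergence in law. It is assumed along sequences, since the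
    exceptional null set may depend on the times chosen; a limit at [0^'+] can be tested on
    sequences. *)
Lemma density_cvg_delta (Z : R -> {RV P >-> R}) (r : R -> R -> R) :
  (forall t, 0 < t -> is_density (Z t) (fun x => r x t)) ->
  (forall u : R^nat, (forall n, 0 < u n) -> u @ \oo --> 0 ->
    {ae P, forall w, Z (u n) w @[n --> \oo] --> 0}) ->
  forall phi : R -> R, continuous phi -> (exists M, forall x, `|phi x| <= M) ->
    \int[mu]_(x in [set: R]) (r x t * phi x) @[t --> 0^'+] --> phi 0.
Proof.
move=> rZ Z0 phi cphi [M phiM].
have M0 : 0 <= M by exact: le_trans (phiM 0).
have mphi : measurable_fun setT phi by exact: continuous_measurable_fun.
apply/cvg_at_rightP => u [u0 ucv].
apply/cvgrPdist_le => e e0.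
have e20 : 0 < e / 2 by rewrite divr_gt0.
have [del del0 hdel] : exists2 del : R, 0 < del &
    forall x, `|x| < del -> `|phi 0 - phi x| <= e / 2.
  have /cvgrPdist_le/(_ _ e20)[del /= del0 hdel] := cphi 0.
  by exists del => // x xdel; apply: hdel; rewrite /= sub0r normrN.
pose A := [set x : R | del <= `|x|].
have mA : measurable A.
  rewrite (_ : A = (fun x : R => `|x|) @^-1` `[del, +oo[%classic); last first.
    by apply/seteqP; split => x; rewrite /A/= in_itv/= andbT.
  by rewrite -[X in measurable X]setTI; apply: measurableT_comp => //.
have mZ n (B : set R) : measurable B -> measurable (Z (u n) @^-1` B).
  by move=> mB; rewrite -[X in measurable X]setTI; exact: measurable_funP.
have pA : P (Z (u n) @^-1` A) @[n --> \oo] --> 0%E.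
  have [|||||_ _ L] := @dominated_convergence _ _ R P setT measurableT
    (fun n w => (\1_(Z (u n) @^-1` A) w : R)%:E) (fun=> 0%E) (fun=> 1%E).
  - by move=> n; apply/measurable_EFinP; apply: measurable_indic; exact: mZ.
  - exact: measurable_cst.
  - apply: filterS (Z0 u u0 ucv) => w Zw _.
    apply: cvg_near_cst.
    move/cvgrPdist_lt : Zw => /(_ _ del0); apply: filterS => n.
    rewrite sub0r normrN => Zdel; rewrite indicE memNset//= /A/=.
    by apply/negP; rewrite -ltNge.
  - exact: integrable_cstP.
  - apply: aeW => w n _; rewrite /= indicE lee_fin.
    by case: (w \in Z (u n) @^-1` A) => /=; rewrite ?normr1 ?normr0.
  rewrite integral0 in L.
  apply: cvg_trans L; apply: near_eq_cvg; apply: nearW => n /=.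
  by rewrite integral_indic// ?setIT//; exact: mZ.
(* Away from [0] the variation of [phi] is at most [2 M], and [2 M * e / (4 (M + 1)) <= e / 2]; the
   [+ 1] covers [M = 0]. *)
have M1 : 0 < 4 * (M + 1) by rewrite mulr_gt0// ltr_wpDl.
have {pA} : \forall n \near \oo, (P (Z (u n) @^-1` A) <= (e / (4 * (M + 1)))%:E)%E.
  have /fine_cvgP[fin /cvgrPdist_le] := pA.
  move=> /(_ (e / (4 * (M + 1)))) [|N1 _ hN1]; first by rewrite divr_gt0.
  near=> n.
  have := hN1 n; rewrite /= sub0r normrN => H.
  have Pf : P (Z (u n) @^-1` A) \is a fin_num.
    by rewrite fin_num_measure//; exact: mZ.
  rewrite -(fineK Pf) lee_fin (le_trans (ler_norm _))// H//=.
  by near: n; exact: nbhs_infty_ge.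
apply: filterS => n pn.
pose f x := r x (u n).
have [mr r0 rE] : is_density (Z (u n)) f by exact: rZ.
change (`|phi 0 - \int[mu]_x (f x * phi x)| <= e).
have f1 : (\int[mu]_x (f x)%:E = 1)%E.
  by rewrite -rE// preimage_setT; exact: probability_setT.
have intf : mu.-integrable setT (fun x => (f x)%:E).
  apply/integrableP; split; first exact/measurable_EFinP.
  rewrite (_ : (\int[mu]_x _)%E = 1%E) ?ltry// -f1.
  by apply: eq_integral => x _; rewrite /= (ger0_norm (r0 x)).
have intM (g : R -> R) K : measurable_fun setT g -> (forall x, `|g x| <= K) ->
    mu.-integrable setT (fun x => (f x * g x)%:E).
  move=> mg gK; apply: (@le_integrableR _ _ _ mu _ (fun x => K * f x)).
  - exact: measurable_funM.
  - exact: integrableZR.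
  - by move=> x; rewrite normrM (ger0_norm (r0 x)) mulrC ler_wpM2r//; exact: r0.
have Rf1 : \int[mu]_x f x = 1 by rewrite /Rintegral f1.
have fA : \int[mu]_x (f x * \1_A x) <= e / (4 * (M + 1)).
  rewrite (_ : \int[mu]_x _ = fine (P (Z (u n) @^-1` A))); last first.
    rewrite rE// [in RHS]integral_mkcond /Rintegral; congr fine.
    apply: eq_integral => x _.
    by rewrite /patch indicE; case: ifP; rewrite ?mulr1 ?mulr0.
  rewrite -lee_fin fineK// fin_num_measure//; exact: mZ.
have mD : measurable_fun setT (fun x => phi 0 - phi x) by exact: measurable_funB.
have phi2 x : `|phi 0 - phi x| <= M + M.
  by rewrite (le_trans (ler_normB _ _))// lerD.
have ind1 x : `|\1_A x : R| <= 1 by rewrite indicE; case: (x \in _); rewrite ?normr1 ?normr0.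
have -> : phi 0 - \int[mu]_x (f x * phi x) = \int[mu]_x (f x * (phi 0 - phi x)).
  rewrite -[X in X - _]mul1r -Rf1 -RintegralZr// -RintegralB//.
  - by apply: eq_Rintegral => x _; rewrite mulrBr.
  - by apply: (@intM (fun=> phi 0) M).
  - exact: (@intM phi M).
apply: le_trans (le_normr_Rintegral _ _) _ => //.
  exact: (@intM _ (M + M)).
have iD := @intM _ (M + M) mD phi2.
have iA : mu.-integrable setT (fun x => (f x * \1_A x)%:E).
  by apply: (@intM _ 1) => //; exact: measurable_indic.
(* The first term bounds the part [|x| < del] by continuity of [phi], the second the tail [A]. *)
apply: (@le_trans _ _ (\int[mu]_x (e / 2 * f x + (M + M) * (f x * \1_A x)))).
  apply: le_Rintegral => //.
  - exact: integrable_abse iD.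
  - by apply: integrableDR; exact: integrableZR.
  - move=> x _; rewrite normrM (ger0_norm (r0 x)) indicE.
    case: (boolP (x \in A)) => xA.
      rewrite mulr1 (@le_trans _ _ (f x * (M + M)))// ?ler_wpM2l//.
      by rewrite mulrC lerDr mulr_ge0// ltW.
    rewrite !mulr0 addr0 mulrC ler_wpM2r// hdel//.
    by move: xA; rewrite notin_setE /A/= => /negP; rewrite -ltNge.
rewrite RintegralD//; [|exact: integrableZR|exact: integrableZR].
rewrite RintegralZl// RintegralZl// Rf1 mulr1.
apply: (@le_trans _ _ (e / 2 + (M + M) * (e / (4 * (M + 1))))).
  by rewrite lerD2l ler_wpM2l// addr_ge0.
have -> : (M + M) * (e / (4 * (M + 1))) = (e / 2) * (M / (M + 1)).
  by field; rewrite gt_eqF// ltr_wpDl.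
have : M / (M + 1) <= 1 by rewrite ler_pdivrMr ?mul1r ?lerDl// ltr_wpDl.
by move=> /(ler_wpM2l (ltW e20)); rewrite mulr1 => h; rewrite [leRHS](splitr e) lerD2l.
Unshelve. all: by end_near. Qed.

End initial_condition.

(** With variance [2 t] the transform of [B s] is [exp (- s xi^2)] and its generator is [d^2/dx^2],
    which matches the symbol [lambda + xi^2]. A density is fixed only up to null sets while the
    equation is pointwise, hence the existential statement; continuity in [x] determines
    [r (., t)]. *)
Theorem proposition5p3 (d : measure_display) (T : measurableType d)
    (R : realType) (P : probability T R)
    (alpha1 alpha2 lambda1 lambda2 c1 c2 : R)
    (halpha1 : 0 < alpha1 < 1) (halpha2 : 0 < alpha2 < 1)
    (hlambda1 : 0 < lambda1) (hlambda2 : 0 < lambda2)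
    (hc1 : 0 <= c1) (hc2 : 0 <= c2) (hc : c1 + c2 = 1)
    (B S Z : R -> {RV P >-> R})
    (hB : brownian_motion 2 B)
    (hS : mixture_tempered_stable_subordinator
            c1 alpha1 lambda1 c2 alpha2 lambda2 S)
    (hBS : independent_processes B S)
    (hZ : forall t, 0 <= t -> {ae P, forall w, Z t w = B (S t w) w}) :
  exists r : R -> R -> R,
    [/\ forall t, 0 < t ->
          is_density (Z t) (fun x => r x t) /\ continuous (fun x => r x t),
        forall x t, 0 < t ->
          [/\ frac_dom lambda1 alpha1 (fun y => r y t),
              frac_dom lambda2 alpha2 (fun y => r y t) &
              is_derive t 1 (fun u => r x u)
                (- c1 * frac_op lambda1 alpha1 (fun y => r y t) x
                 - c2 * frac_op lambda2 alpha2 (fun y => r y t) x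
                 + c1 * lambda1 `^ alpha1 * r x t
                 + c2 * lambda2 `^ alpha2 * r x t)],
        initial_delta Z r &
        forall t, 0 < t ->
          [/\ r x t @[x --> +oo] --> 0,
              r x t @[x --> -oo] --> 0,
              forall x, derivable (fun y => r y t) x 1,
              derive1 (fun y => r y t) x @[x --> +oo] --> 0 &
              derive1 (fun y => r y t) x @[x --> -oo] --> 0]].
Proof.
case: hB => B0 _ Blaw Bcont.
case: hS => [[[S0 _ _ _ Scad] Smono] SL].
pose psi := mixture_symbol alpha1 alpha2 lambda1 lambda2 c1 c2.
have SLap s t : 0 < s -> 0 <= t ->
    (\int[P]_w (expR (- s * S t w))%:E = (expR (- (t * psi s)))%:E)%E.
  move=> s0 t0; have := SL s t s0 t0; rewrite unlock => ->; congr (expR _)%:E.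
  by rewrite /psi /mixture_symbol /bernstein; ring.
have S_gt0 t : 0 < t -> {ae P, forall w, 0 < S t w}.
  move=> t0; have [C C0 hC] := expR_mixture_symbol_le _ _ _ _ _ _ halpha1 halpha2
    hlambda1 hlambda2 hc1 hc2 hc t t0.
  apply: (ae_gt0_of_laplace P (S t) C) => // s s0.
  by rewrite SLap ?(ltW t0)// lee_fin hC// ltW.
(* Positive everywhere and almost surely equal to [S t] when [t > 0]; the value [1] on the null set
   is arbitrary. *)
pose Y t w := if 0 < S t w then S t w else 1.
have mY t : measurable_fun setT (Y t).
  by apply: measurable_fun_ifT => //; exact: measurable_fun_ltr.
have Y0 t w : 0 < Y t w by rewrite /Y; case: ifP.
have YS t : 0 < t -> {ae P, forall w, Y t w = S t w}.
  by move=> t0; apply: filterS (S_gt0 t t0) => w; rewrite /Y => ->.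
have LY t s : 0 < t -> 0 <= s -> laplace P (Y t) s = expR (- (t * psi s)).
  (* The transform of [S] is given for [s > 0]; at [s = 0] both sides are [1]. *)
  move=> t0; rewrite le_eqVlt => /predU1P[<-|s0].
    rewrite /laplace; under eq_Rintegral do rewrite mulr0 oppr0 expR0.
    rewrite Rintegral_cst_probability /psi /mixture_symbol /bernstein !add0r.
    by rewrite !subrr !mulr0 addr0 mulr0 oppr0 expR0.
  transitivity (fine (\int[P]_w (expR (- s * S t w))%:E)%E); last first.
    by rewrite (SLap _ _ s0 (ltW t0)).
  congr fine; apply: (@ae_eq_integral _ _ _ P) => //.
  - apply/measurable_EFinP; apply: measurableT_comp => //; apply: measurableT_comp => //.
    exact: measurable_funM.
  - apply/measurable_EFinP; apply: measurableT_comp => //.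
    exact: measurable_funM.
  - by apply: filterS (YS t t0) => w -> _; congr (expR _)%:E; ring.
have iY t : 0 < t -> P.-integrable setT (fun w => (Y t w)^-1%:E).
  move=> t0; have [C C0 hC] := expR_mixture_symbol_le _ _ _ _ _ _ halpha1 halpha2
    hlambda1 hlambda2 hc1 hc2 hc t t0.
  apply: (integrable_inverse P (Y t) (mY t) (Y0 t) C) => s s0.
  by rewrite LY// hC.
have mpre (X : {RV P >-> R}) (U : set R) : measurable U -> measurable (X @^-1` U).
  by move=> mU; rewrite -[X in measurable X]setTI; exact: measurable_funP.
have B_heat s U : 0 < s -> measurable U -> P (B s @^-1` U) = heat_measure s U.
  (* The Gaussian law is known for increments, and [B 0 = 0] holds only almost surely. *)
  move=> s0 mU; transitivity (P [set w | U (B s w - B 0 w)]).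
    apply: ae_measure_eq => //; first exact: mpre.
    - rewrite -[X in measurable X]setTI.
      by apply: (measurable_funB (f := B s) (g := B 0)).
    - by apply: filterS B0 => w /= ->; rewrite subr0.
  rewrite Blaw// subr0 /normal_prob /heat_measure.
  by apply: eq_integral => x _; rewrite heat_normal_pdf.
have bigcap1 (V : set T) : \bigcap_(i in [set: 'I_1]) V = V.
  by apply/seteqP; split => w; [move=> /(_ ord0 I)|move=> Vw i _].
have BY_indep t s U C : 0 < t -> 0 <= s -> measurable U -> measurable C ->
    P (B s @^-1` U `&` Y t @^-1` C) = (P (B s @^-1` U) * P (Y t @^-1` C))%E.
  move=> t0 s0 mU mC.
  have mYC : measurable (Y t @^-1` C).
    by rewrite -[X in measurable X]setTI; exact: mY.
  have -> : P (B s @^-1` U `&` Y t @^-1` C) = P (B s @^-1` U `&` S t @^-1` C).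
    apply: ae_measure_eq; [by apply: measurableI => //; exact: mpre|
      by apply: measurableI; exact: mpre|].
    by apply: filterS (YS t t0) => w /= ->.
  have -> : P (Y t @^-1` C) = P (S t @^-1` C).
    apply: ae_measure_eq => //; first exact: mpre.
    by apply: filterS (YS t t0) => w /= ->.
  have := hBS 1%N 1%N (fun=> s) (fun=> t) (fun=> U) (fun=> C).
  by rewrite /= !bigcap1; apply => // _; exact: ltW.
have ZY t : 0 < t -> {ae P, forall w, Z t w = B (Y t w) w}.
  by move=> t0; apply: filterS2 (YS t t0) (hZ t (ltW t0)) => w ->.
have dens t : 0 < t -> is_density (Z t) (fun x => heat_mix P (Y t) x).
  move=> t0; split.
  - apply: continuous_measurable_fun.
    exact: (continuous_heat_mix P (Y t) (mY t) (Y0 t) (iY t t0)).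
  - by move=> x; exact: heat_mix_ge0.
  - move=> A mA; apply: (law_subordinated P B (Y t) (Z t) (mY t) (Y0 t) (iY t t0)) => //.
      by move=> s U C s0 mU mC; exact: BY_indep.
    exact: ZY.
exists (fun x t => heat_mix P (Y t) x); split.
- move=> t t0; split; first exact: dens.
  exact: (continuous_heat_mix P (Y t) (mY t) (Y0 t) (iY t t0)).
- move=> x t t0; split.
  + exact: (frac_dom_mixture P alpha1 alpha2 lambda1 lambda2 c1 c2 halpha1 halpha2
      hlambda1 hlambda2 hc1 hc2 hc Y (fun t _ => mY t) (fun t w _ => Y0 t w) iY LY).
  + exact: (frac_dom_mixture P alpha1 alpha2 lambda1 lambda2 c1 c2 halpha1 halpha2
      hlambda1 hlambda2 hc1 hc2 hc Y (fun t _ => mY t) (fun t w _ => Y0 t w) iY LY).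
  + exact: (is_derive_mixture P alpha1 alpha2 lambda1 lambda2 c1 c2 halpha1 halpha2
      hlambda1 hlambda2 hc1 hc2 hc Y (fun t _ => mY t) (fun t w _ => Y0 t w) iY LY).
- split.
  + move=> A mA.
    have Z0 : {ae P, forall w, Z 0 w = 0}.
      by apply: filterS3 B0 S0 (hZ 0 (lexx 0)) => w Bw Sw ->; rewrite Sw.
    rewrite diracE; case: (boolP (0 \in A)) => A0.
      transitivity (P setT); last exact: probability_setT.
      apply: ae_measure_eq => //; first exact: mpre.
      by apply: filterS Z0 => w /= ->; move: A0; rewrite inE.
    transitivity (P set0); last exact: measure0.
    apply: ae_measure_eq => //; first exact: mpre.
    by apply: filterS Z0 => w /= ->; move: A0; rewrite notin_setE.
  + apply: (density_cvg_delta P Z (fun x t => heat_mix P (Y t) x) dens) => u u0 ucv.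
    (* Countably many times share one null set. *)
    have Zu : {ae P, forall w, forall n, Z (u n) w = B (S (u n) w) w}.
      by apply: ae_foralln => n; apply: hZ; exact: ltW.
    apply: filterS3 B0 (filterI S0 (filterI Scad Smono)) (filterI Bcont Zu)
      => w Bw [Sw [[cS _] Sm]] [cB Zw].
    (* Monotonicity from [S 0 = 0] keeps the random times in the half-line on which the paths of [B]
       are continuous. *)
    have S_ge0 n : 0 <= S (u n) w by rewrite -Sw; apply: Sm; rewrite ?lexx ?ltW.
    have Su : S (u n) w @[n --> \oo] --> 0.
      by rewrite -[X in _ --> X]Sw; move/cvg_at_rightP : (cS 0 (lexx 0)); apply.
    rewrite (_ : (fun n => Z (u n) w) = (fun n => B (S (u n) w) w)); last first.
      by apply/funext => n.
    rewrite -[X in _ --> X]Bw.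
    apply: (cvg_comp (fun n => S (u n) w) (fun t => B t w)); last first.
      by move/subspace_continuousP : cB; apply; rewrite /=.
    move=> V /= hV; have [N _ hN] := Su _ hV; exists N => // n /= Nn.
    by apply: (hN n Nn); exact: S_ge0.
- move=> t t0.
  have D := is_derive_heat_mix P (Y t) (mY t) (Y0 t) (iY t t0).
  have [l1 l2] := cvg_heat_mix P (Y t) (mY t) (Y0 t) (iY t t0).
  have [l3 l4] := cvg_derive1_heat_mix P (Y t) (mY t) (Y0 t) (iY t t0).
  by split=> // x; case: (D x).
Qed.
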